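(* Let $G=(\mathbb V,\mathbb E,w)$ be a connected undirected graph with $n=|\mathbb V|\ge 2$ vertices and nonnegative edge weights, and let $\epsilon\in(0,2)$, $\delta\in(0,1/e]$, $\gamma\in(0,1)$. Run Algorithm A (described in the context) on $G$ with parameters $\epsilon,\delta,\gamma$, producing the graph $G'=(\mathbb V,\mathbb E_0\cup\mathbb E_1,w')$, and let $\hat d(u,v)$ denote the shortest-path distance between $u$ and $v$ in $G'$ with weights $w'$. Then the output $G'$ is $(\epsilon,\delta)$-differentially private with respect to $w$, and there is a universal constant $C>0$ such that, with probability at least $1-4\gamma$, all weights $w'$ are nonnegative and $$|\hat d(u,v)-d_G(u,v)|\le C\,\epsilon^{-1}\,n^{1/2}\,\log^2(n/\gamma)\,\sqrt{\log(1/\delta)}\qquad\text{for all }u,v\in\mathbb V,$$ where $d_G(u,v)$ is the true shortest-path distance in $G$.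
   Context: $Lap(\mu,\sigma)$ denotes the Laplace distribution with location $\mu$ and scale $\sigma>0$, density $\frac{1}{2\sigma}e^{-|x-\mu|/\sigma}$. Two weight functions $w,\tilde w$ on the same graph $(\mathbb V,\mathbb E)$ are neighboring if $\sum_{e\in\mathbb E}|w(e)-\tilde w(e)|\le 1$. A randomized algorithm $\mathcal A$ is $(\epsilon,\delta)$-differentially private (w.r.t. weights) if for all neighboring $w,\tilde w$ and all measurable sets $O$ of outputs, $\Pr[\mathcal A(w)\in O]\le e^{\epsilon}\Pr[\mathcal A(\tilde w)\in O]+\delta$. Algorithm A (input: $G=(\mathbb V,\mathbb E,w)$, $n=|\mathbb V|$, parameters $\epsilon,\delta,\gamma$; assume $n^{1/2}$ is an integer): (1) Set $\epsilon'=\epsilon/2$. (2) Choose $\mathbb V_1\subseteq\mathbb V$ uniformly at random among all subsets of size $n^{1/2}$, independently of $w$. (3) Let $\mathbb E_1=\{\{u,v\}:u,v\in\mathbb V_1,u\ne v\}$ and $\mathbb E_0=\mathbb E\setminus\mathbb E_1$ (the edges of $G$ not having both endpoints in $\mathbb V_1$). (4) For each $e=\{u,v\}\in\mathbb E_1$, set $w'(e)=d_G(u,v)+X_e$ with $X_e\sim Lap(\mu_1,\sigma_1)$, where $\sigma_1=2\sqrt2\,n^{1/2}\sqrt{\log(1/\delta)}/\epsilon'$ and $\mu_1=\sigma_1\log(n/\gamma)$. (5) For each $e\in\mathbb E_0$, set $w'(e)=w(e)+X_e$ with $X_e\sim Lap(\mu_0,\sigma_0)$, where $\sigma_0=1/\epsilon'$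 and $\mu_0=\sigma_0\log(n^2/\gamma)$. All noise variables are independent. (6) Output $G'=(\mathbb V,\mathbb E_0\cup\mathbb E_1,w')$ (and its all-pairs shortest-path distances). *)

(* Defs.v *)
From HB Require Import structures.
From mathcomp Require Import all_boot all_order all_algebra.
From mathcomp Require Import all_classical all_reals all_analysis.
Set Implicit Arguments. Unset Strict Implicit. Unset Printing Implicit Defensive.
Import Order.TTheory GRing.Theory Num.Theory.
Import numFieldNormedType.Exports.
Local Open Scope classical_set_scope.
Local Open Scope ring_scope.

(* Vertices are 'I_n; undirected edges / unordered vertex pairs {u,v} are
   encoded as ordered pairs (u,v) with u < v. *)
Definition upair (n : nat) := {p : 'I_n * 'I_n | (p.1 < p.2)%N}.

Section Defs.
Variable R : realType.

Definition joins n (e : upair n) (u v : 'I_n) : bool :=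
  (((val e).1 == u) && ((val e).2 == v)) || (((val e).1 == v) && ((val e).2 == u)).

Definition adjb n (E : {set upair n}) : rel 'I_n :=
  fun u v => [exists e in E, joins e u v].

(* weight of the edge {u,v} (its unique representative in E) *)
Definition ewt n (E : {set upair n}) (w : upair n -> R) (u v : 'I_n) : R :=
  \sum_(e in E | joins e u v) w e.

Fixpoint walk_weight n (E : {set upair n}) (w : upair n -> R) (u : 'I_n)
  (p : seq 'I_n) : R :=
  if p is v :: p' then ewt E w u v + walk_weight E w v p' else 0.

Definition dist n (E : {set upair n}) (w : upair n -> R) (u v : 'I_n) : \bar R :=
  ereal_inf [set (walk_weight E w u p)%:E | p in
              [set p : seq 'I_n | path (adjb E) u p && (last u p == v)]].

Definition connected_graph n (E : {set upair n}) : Prop :=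
  forall u v : 'I_n, connect (adjb E) u v.

Definition nonneg_weights n (E : {set upair n}) (w : upair n -> R) : Prop :=
  forall e, e \in E -> 0 <= w e.

Definition neighboring n (E : {set upair n}) (w w' : upair n -> R) : Prop :=
  \sum_(e in E) `|w e - w' e| <= 1.

Definition laplace_pdf (mu sigma x : R) : R :=
  (2 * sigma)^-1 * expR (- `|x - mu| / sigma).

Definition laplace_prob (mu sigma : R) (B : set R) : R :=
  fine (\int[lebesgue_measure]_(x in B) (laplace_pdf mu sigma x)%:E)%E.

(* sigma-algebra on outputs  ({set upair n} * (upair n -> R)):
   the edge-set component is discrete, the weight vector component
   carries the product Borel sigma-algebra of R^(upair n). *)
Definition boxes (I : Type) : set (set (I -> R)) :=
  [set B | exists Bs : I -> set R,
      (forall i, measurable (Bs i)) /\ B = [set x | forall i, Bs i (x i)]].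

Definition out_measurable n (O : set ({set upair n} * (upair n -> R))) : Prop :=
  forall S : {set upair n},
    smallest (sigma_algebra setT) (@boxes (upair n)) [set x | O (S, x)].

Definition in_E1 n (V1 : {set 'I_n}) (e : upair n) : bool :=
  ((val e).1 \in V1) && ((val e).2 \in V1).

Definition outE n (E : {set upair n}) (V1 : {set 'I_n}) : {set upair n} :=
  [set e | in_E1 V1 e] :|: [set e in E | ~~ in_E1 V1 e].

(* w' (set to 0 outside E0 ∪ E1); Z1 e ~ Lap(mu1,sigma1), Z0 e ~ Lap(mu0,sigma0) *)
Definition outW n (E : {set upair n}) (w : upair n -> R) (V1 : {set 'I_n})
  (Z0 Z1 : upair n -> R) : upair n -> R :=
  fun e => if in_E1 V1 e then fine (dist E w (val e).1 (val e).2) + Z1 e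
           else if e \in E then w e + Z0 e else 0.

Definition algA_output n (E : {set upair n}) (w : upair n -> R) (V1 : {set 'I_n})
  (Z0 Z1 : upair n -> R) : {set upair n} * (upair n -> R) :=
  (outE E V1, outW E w V1 Z0 Z1).

(* parameters; k = n^{1/2} *)
Definition sigma1 (k : nat) (eps delta : R) : R :=
  2 * Num.sqrt 2 * k%:R * Num.sqrt (ln (delta^-1)) / (eps / 2).
Definition mu1 (n k : nat) (eps delta gamma : R) : R :=
  sigma1 k eps delta * ln (n%:R / gamma).
Definition sigma0 (eps : R) : R := (eps / 2)^-1.
Definition mu0 (n : nat) (eps gamma : R) : R :=
  sigma0 eps * ln ((n ^ 2)%:R / gamma).

(* The random choices of Algorithm A, realized on a probability space:
   V1 is uniform among k-subsets, the Z0 e, Z1 e are Laplace, and all are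
   mutually independent (joint law given on all rectangles). *)
Definition algA_randomness d (Omega : measurableType d) (P : probability Omega R)
  (n k : nat) (eps delta gamma : R)
  (V1 : Omega -> {set 'I_n}) (Z0 Z1 : upair n -> Omega -> R) : Prop :=
  [/\ forall S, measurable (V1 @^-1` [set S]),
      forall e, measurable_fun setT (Z0 e),
      forall e, measurable_fun setT (Z1 e) &
      forall (S : {set 'I_n}) (B0 B1 : upair n -> set R),
        (forall e, measurable (B0 e)) -> (forall e, measurable (B1 e)) ->
        P [set om | V1 om = S /\ forall e, B0 e (Z0 e om) /\ B1 e (Z1 e om)]
        = ((if #|S| == k then ('C(n, k))%:R^-1 else 0) *
           \prod_(e : upair n)
              (laplace_prob (mu0 n eps gamma) (sigma0 eps) (B0 e) *
               laplace_prob (mu1 n k eps delta gamma) (sigma1 k eps delta) (B1 e)))%:E].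

End Defs.

(* Main.v *)
Require Import Defs.
From HB Require Import structures.
From mathcomp Require Import all_boot all_order all_algebra.
From mathcomp Require Import all_classical all_reals all_analysis.
From mathcomp Require Import measurable_realfun ring lra zify.
Import Order.TTheory GRing.Theory Num.Theory.
Import numFieldNormedType.Exports.
Set Implicit Arguments. Unset Strict Implicit. Unset Printing Implicit Defensive.

(** Privacy. Fix the value S of V1. The output is a fixed function of independent Laplace variables
    shifted by a vector of centers, so changing the weights only shifts the noise. Shifting a single
    coordinate changes the law by the density exp(loss); chaining this over the coordinates gives the
    density of the whole change as the exponential of the sum of the losses. On the pairs inside S
    every distance moves by at most 1, hence every loss is at most 1 / sigma1. The moments of the
    total loss are bounded one coordinate at a time: by convexity exp(a x) lies below a chord that is
    affine in exp x, and exp(loss) integrates to 1. The Chernoff bound with exponent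
    3 ln(1/delta) / (eps/2) then gives (eps/2, delta)-privacy for these pairs, the budget being
    small enough since there are at most k^2/2 of them. The remaining edges have total sensitivity 1
    and give (eps/2, 0)-privacy.

    Accuracy. With probability at least 1 - 2 gamma all the relevant noises lie in [0, 2 mu], so that
    distances can only grow. Fix for each pair (u,v) a simple path of weight less than d(u,v) + 1. With
    probability at least 1 - 2 gamma^2, V1 meets the first and the last 2 k ln(n/gamma) vertices of all
    these paths that are long enough. Going along the path to its first vertex in V1, jumping to its last
    vertex in V1 and going on along the path uses few noisy edges and a single noisy distance. *)

(** * Counting *)

Section Counting.

(** A uniform k-subset misses a fixed h-set with probability at most (1 - h/n)^k, written here
    without division. After clearing k! the falling factorials compare factor by factor, as (n - h -
    i) n <= (n - i) (n - h). *)
Lemma bin_sub_leq (n h k : nat) : ('C(n - h, k) * n ^ k <= 'C(n, k) * (n - h) ^ k)%N.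
Proof.
suff H : ((n - h) ^_ k * n ^ k <= n ^_ k * (n - h) ^ k)%N.
  by rewrite -(leq_pmul2r (fact_gt0 k)) mulnAC bin_ffact [leqRHS]mulnAC bin_ffact.
elim: k => [//|k IH]; rewrite !ffactnSr !expnSr.
rewrite mulnACA [leqRHS]mulnACA; apply: leq_mul => //.
by have [hn|hn] := leqP n h; [rewrite (eqP hn)|nia].
Qed.

(** The sets that miss [w] are the k-subsets of its complement. *)
Lemma card_missing_window (T : finType) (k : nat) (w : seq T) : uniq w ->
  #|[set S : {set T} | (#|S| == k) && ~~ has (mem S) w]| = 'C(#|T| - size w, k).
Proof.
move=> uw; pose B := ~: [set x in w].
have -> : (#|T| - size w)%N = #|B|.
  by rewrite cardsCs finset.setCK cardsE (card_uniqP uw).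
rewrite -cards_draws; congr #|pred_of_set _|; apply/finset.setP => S; rewrite !inE andbC; congr (_ && _).
apply/hasPn/fintype.subsetP => [h x xS|h x xw]; last by apply/negP => /h; rewrite !inE xw.
by rewrite !inE; apply/negP => /h /negP; apply.
Qed.

Lemma card_missing_windows_leq (T : finType) (k h : nat) (ws : seq (seq T)) :
  (forall w, w \in ws -> uniq w /\ size w = h) ->
  (#|[set S : {set T} | (#|S| == k) && ~~ all (has (mem S)) ws]| <= size ws * 'C(#|T| - h, k))%N.
Proof.
elim: ws => [_|w ws IH hws].
  by rewrite (_ : [set _ | _] = finset.set0) ?cards0//; apply/finset.setP => S; rewrite !inE andbF.
have [uw sw] := hws w (mem_head _ _).
have {}IH := IH (fun v vws => hws v (mem_behead (s := w :: ws) vws)).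
rewrite mulSn; apply: leq_trans (leq_add (leqnn _) IH).
rewrite -sw -card_missing_window//; apply: leq_trans (leq_card_setU _ _).
apply: subset_leq_card; apply/fintype.subsetP => S; rewrite !inE /= negb_and.
by case: (#|S| == k).
Qed.

(** Complement of the union bound over the windows, in additive form because subtraction on [nat]
    truncates. *)
Lemma bin_leq_card_hitting (T : finType) (k h : nat) (ws : seq (seq T)) :
  (forall w, w \in ws -> uniq w /\ size w = h) ->
  ('C(#|T|, k) <= #|[set S : {set T} | (#|S| == k) && all (has (mem S)) ws]| +
     size ws * 'C(#|T| - h, k))%N.
Proof.
move=> hws; apply: leq_trans (leq_add (leqnn _) (card_missing_windows_leq k hws)).
rewrite -card_draws; apply: leq_trans (leq_card_setU _ _).
by apply: subset_leq_card; apply/fintype.subsetP => S; rewrite !inE => ->; case: all.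
Qed.

Lemma card_upair_leq n : (#|{: upair n}| <= n ^ 2)%N.
Proof. by have := @leq_card _ _ (val : upair n -> _) val_inj; rewrite card_prod card_ord mulnn. Qed.

(** Each pair and its swap lie in S x S, and the two images are disjoint because pairs are strictly
    ordered. The factor 2 enters the privacy budget. *)
Lemma card_in_E1_leq n (S : {set 'I_n}) : (2 * #|[set e | in_E1 S e]| <= #|S| ^ 2)%N.
Proof.
set J := [set e | _].
pose f (e : upair n) := val e; pose g (e : upair n) := ((val e).2, (val e).1).
have fI : injective f by exact: val_inj.
have gI : injective g by move=> e e' [h1 h2]; apply/val_inj/injective_projections.
have dis : [disjoint f @: J & g @: J].
  apply/pred0P => p /=; apply/negbTE/negP => /andP[/imsetP[e _ ->] /imsetP[e' _ E]].
  have := valP e; have := valP e'; move: E; rewrite /f /g => -> /=; lia.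
rewrite mul2n -addnn -{1}(card_imset _ fI) -(card_imset _ gI) -mulnn -cardsX.
have := leq_card_setU (f @: J) (g @: J); move=> /leqifP; rewrite dis => /eqP <-.
apply: subset_leq_card; apply/fintype.subsetP => p; rewrite !inE => /orP[] /imsetP[e]; rewrite inE => /andP[h1 h2] ->.
  by rewrite h1 h2.
by rewrite /= h1 h2.
Qed.

End Counting.

Local Open Scope classical_set_scope.
Local Open Scope ring_scope.

(** * Real inequalities *)

Section RealInequalities.
Variable R : realType.
Implicit Types x y z t a : R.

(** A weak form of cosh z <= exp(z^2 / 2) that suffices for the budget. For z >= 1/2 one has z <= 2
    z^2; for smaller z, exp z <= 1 / (1 - z) gives cosh z <= 1 / (1 - z^2) <= 1 + 2 z^2. *)
Lemma cosh_le_expR_sqr z : (expR z + expR (- z)) / 2 <= expR (2 * z ^+ 2).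
Proof.
wlog z0 : z / 0 <= z.
  move=> H; have [/H//|/ltW z0] := leP 0 z.
  have := H (- z); rewrite opprK sqrrN addrC; apply; lra.
have [z12|z12] := leP (2^-1) z.
  have h1 : expR z <= expR (2 * z ^+ 2) by rewrite ler_expR; nra.
  have h2 : expR (- z) <= expR (2 * z ^+ 2) by rewrite ler_expR; nra.
  lra.
have e1 : expR z <= (1 - z)^-1.
  rewrite -[leLHS]invrK -expRN lef_pV2; first exact: expR_ge1Dx.
    by rewrite posrE expR_gt0.
  by rewrite posrE; lra.
have e2 : expR (- z) <= (1 + z)^-1.
  rewrite expRN lef_pV2; first exact: expR_ge1Dx.
    by rewrite posrE expR_gt0.
  by rewrite posrE; lra.
have e3 : 1 + 2 * z ^+ 2 <= expR (2 * z ^+ 2) by exact: expR_ge1Dx.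
apply: le_trans e3.
have e4 : ((1 - z)^-1 + (1 + z)^-1) / 2 = (1 - z ^+ 2)^-1.
  by field; do ?[apply/andP; split]; apply: lt0r_neq0; nra.
apply: (@le_trans _ _ (1 - z ^+ 2)^-1); first by rewrite -e4; lra.
have z2 : 0 <= z ^+ 2 <= 4^-1 by apply/andP; split; nra.
rewrite -div1r; set q := z ^+ 2 in z2 *; have /andP[q0 q4] := z2.
by rewrite ler_pdivrMr; nra.
Qed.

(* The chord of the convex function y |-> y^a over [e^-t, e^t], written as an affine function of
   y = e^x; its value at y = 1 is at most cosh (a t). *)
Lemma expR_chord a t : 1 <= a -> 0 < t -> exists2 B : R, 0 <= B &
  forall x, `|x| <= t -> expR (a * x) <= expR (2 * (a * t) ^+ 2) + B * (expR x - 1).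
Proof.
move=> a1 t0.
have a0 : 0 < a by lra.
have et : expR (- t) < 1 by rewrite expR_lt1; lra.
have et' : 1 < expR t by rewrite expR_gt1.
have D0 : 0 < expR t - expR (- t) by lra.
have at0 : expR (- (a * t)) < expR (a * t).
  by rewrite ltr_expR; have := mulr_gt0 a0 t0; lra.
exists ((expR (a * t) - expR (- (a * t))) / (expR t - expR (- t))).
  by apply: divr_ge0; lra.
move=> x; rewrite ler_norml => /andP[tx xt].
have ex1 : expR (- t) <= expR x by rewrite ler_expR.
have ex2 : expR x <= expR t by rewrite ler_expR.
(* The weight [th] makes exp x the convex combination of exp t and exp(-t), to which convexity of
   y^a is applied. *)
pose th : R := (expR x - expR (- t)) / (expR t - expR (- t)).
have th01 : 0 <= th <= 1.
  by rewrite /th; apply/andP; split; [apply: divr_ge0; lra|rewrite ler_pdivrMr //; lra].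
have /andP[th0 th1] := th01.
have ch : expR (a * x) <= th * expR (a * t) + (1 - th) * expR (- (a * t)).
  have tI : Itv.spec (@Itv.num_sem R) (Itv.Real `[0%Z, 1%Z]) th.
    by rewrite /= /Itv.num_sem/= in_itv/= th0 th1 ger0_real.
  have cvx : (th * expR t + (1 - th) * expR (- t)) `^ a <=
      th * expR t `^ a + (1 - th) * expR (- t) `^ a.
    have := @convex_powR R a a1 (Itv.mk tI) (expR t) (expR (- t)).
    by rewrite !inE /= !in_itv/= !andbT !expR_ge0 => /(_ isT isT); rewrite !convRE.
  rewrite -!expRM mulNr ![t * a]mulrC in cvx; apply: le_trans cvx.
  rewrite (_ : _ + _ = expR x) -?expRM 1?[x * a]mulrC //.
  by rewrite /th; field; apply: lt0r_neq0.
apply: le_trans ch _.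
apply: (le_trans _ (lerD (cosh_le_expR_sqr (a * t)) (lexx _))).
set p := expR (a * t) in at0 *; set q := expR (- (a * t)) in at0 *.
have thE : th = (1 - expR (- t)) / (expR t - expR (- t)) + (expR x - 1) / (expR t - expR (- t)).
  by rewrite /th; field; apply: lt0r_neq0.
(* At x = 0 the weight is 1 / (1 + exp t) <= 1/2, so that the chord at y = 1 lies below the mean of
   its end values, cosh(a t). *)
have th12 : (1 - expR (- t)) / (expR t - expR (- t)) <= 2^-1.
  rewrite ler_pdivrMr //.
  have : expR t * expR (- t) = 1 by rewrite -expRD subrr expR0.
  by nra.
set v := (1 - expR (- t)) / _ in thE th12.
have -> : (p - q) / (expR t - expR (- t)) * (expR x - 1) = (p - q) * ((expR x - 1) / (expR t - expR (- t))).
  by rewrite mulrAC mulrA.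
set u := (expR x - 1) / _ in thE *.
rewrite thE; nra.
Qed.

End RealInequalities.

(** * Numerical estimates behind the constants *)

Section Numeric.
Variable R : realType.
Implicit Types (a e l L g : R).

(** Weierstrass product inequality: the union bound for independent events. The induction also
    carries that the product lies in [0, 1]. *)
Lemma prod_1B_ge (I : finType) (a : I -> R) : (forall i, 0 <= a i <= 1) ->
  1 - \sum_i a i <= \prod_i (1 - a i).
Proof.
move=> a01; suff [] : 1 - \sum_i a i <= \prod_i (1 - a i) /\ 0 <= \prod_i (1 - a i) <= 1 by [].
apply: (big_ind2 (fun x y => 1 - x <= y /\ 0 <= y <= 1)).
- by split; lra.
- by move=> x y x' y' [h1 h2] [h3 h4]; split; nra.
- by move=> i _; have := a01 i; split; lra.
Qed.

Lemma bin_sub_le_expR (n h k : nat) : (0 < n)%N ->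
  ('C(n - h, k))%:R <= 'C(n, k)%:R * expR (- (h%:R * k%:R / n%:R)) :> R.
Proof.
move=> n0; have n0' : 0 < n%:R :> R by rewrite ltr0n.
rewrite -(@ler_pM2r _ (n%:R ^+ k)) ?exprn_gt0//.
apply: (@le_trans _ _ ('C(n, k)%:R * (n - h)%:R ^+ k)).
  by rewrite -!natrX -!natrM ler_nat bin_sub_leq.
rewrite -[leRHS]mulrA ler_wpM2l//.
rewrite (_ : - (h%:R * k%:R / n%:R) = k%:R * (- (h%:R / n%:R))); last by ring.
rewrite expRM_natl -exprMn lerXn2r ?nnegrE ?mulr_ge0 ?expR_ge0//.
have [hn|hn] := leqP h n; last by rewrite (eqP (ltnW hn)) mulr_ge0 ?expR_ge0.
rewrite natrB// (_ : n%:R - h%:R = (1 - h%:R / n%:R) * n%:R); last by field; exact: lt0r_neq0.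
by rewrite ler_wpM2r// expR_ge1Dx.
Qed.

(** It suffices that e <= 4, which follows from exp(-1/2) >= 1 - 1/2. *)
Lemma ln_ge1 (x : R) : 4 <= x -> 1 <= ln x.
Proof.
move=> x4; rewrite -[X in X <= _]expRK ler_ln ?posrE ?expR_gt0//; last by lra.
apply: le_trans x4.
have h : 2^-1 <= expR (- 2^-1) :> R.
  by have := @expR_ge1Dx R (- 2^-1); lra.
have h2 : expR (2^-1) <= 2 :> R.
  by rewrite -[X in _ <= X]invrK -[X in X <= _]invrK -expRN lef_pV2 ?posrE ?expR_gt0//; lra.
rewrite (_ : 1 = 2^-1 + 2^-1 :> R); last by field.
by rewrite expRD; have := expR_ge0 (2^-1 : R); nra.
Qed.

(** Here [e] is eps/2, [ell] is ln(1/delta), and the inverted factor is 1 / sigma1. Since e <= ell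
    and 2 J <= k^2, the first term is at most (4 ell)^2 / (8 ell) = 2 ell; the second is 3 ell. The
    difference makes the tail at most delta. *)
Lemma privacy_exponent_le (k : nat) (J e ell : R) : (0 < k)%N -> 0 < e < 1 -> 1 <= ell ->
  0 <= J -> 2 * J <= k%:R ^+ 2 ->
  2 * ((1 + 3 * ell / e) * (2 * Num.sqrt 2 * k%:R * Num.sqrt ell / e)^-1) ^+ 2 * J -
    3 * ell / e * e <= - ell.
Proof.
move=> k0 /andP[e0 e1] ell1 J0 Jk; set l := 3 * ell / e; set t := (_ / e)^-1.
have k0' : 0 < k%:R :> R by rewrite ltr0n.
have s2 : Num.sqrt 2 ^+ 2 = 2 :> R by rewrite sqr_sqrtr.
have sl : Num.sqrt ell ^+ 2 = ell by rewrite sqr_sqrtr; lra.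
have t2 : ((1 + l) * t) ^+ 2 = (e + 3 * ell) ^+ 2 / (8 * k%:R ^+ 2 * ell).
  rewrite exprMn /t exprVn !exprMn s2 sl /l exprVn.
  by field; rewrite !lt0r_neq0//; lra.
rewrite t2 (_ : l * e = 3 * ell); last by rewrite /l; field; exact: lt0r_neq0.
have h : 2 * ((e + 3 * ell) ^+ 2 / (8 * k%:R ^+ 2 * ell)) * J <= 2 * ell.
  rewrite (_ : _ * J = ((e + 3 * ell) ^+ 2 * (2 * J)) / (8 * k%:R ^+ 2 * ell)); last first.
    by field; rewrite !lt0r_neq0//; lra.
  rewrite ler_pdivrMr ?mulr_gt0 ?exprn_gt0//; last by lra.
  apply: (@le_trans _ _ ((4 * ell) ^+ 2 * k%:R ^+ 2)).
    by apply: ler_pM => //; [exact: sqr_ge0|lra|rewrite lerXn2r ?nnegrE; lra].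
  by rewrite le_eqVlt; apply/orP; left; apply/eqP; ring.
lra.
Qed.

Lemma accuracy_bound (kR L sl eps h m0 m1 : R) : 1 <= kR -> 1 <= L -> 1 <= sl -> 0 < eps < 2 ->
  0 <= m0 -> 0 <= h <= 2 * kR * L + 1 -> m0 <= 4 * L / eps ->
  m1 = 2 * Num.sqrt 2 * kR * sl / (eps / 2) * L ->
  1 + (2 * h * (2 * m0) + 2 * m1) <= 100 * eps^-1 * kR * L ^+ 2 * sl.
Proof.
move=> k1 L1 sl1 /andP[e0 e2] m00 /andP[h0 hk] m0L ->.
pose i := eps^-1.
have i2 : 2^-1 <= i by rewrite lef_pV2 ?posrE// ltW.
have s2 : Num.sqrt 2 <= 3 / 2 :> R.
  by rewrite -(@ler_pXn2r _ 2) ?nnegrE ?sqrtr_ge0// ?sqr_sqrtr//; lra.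
have kL : 1 <= kR * L by rewrite -[X in X <= _]mulr1 ler_pM.
have h3 : h <= 3 * (kR * L) by lra.
have iL : 0 <= i * L by rewrite mulr_ge0//; lra.
have X1 : h * m0 <= 3 * (kR * L) * (4 * (i * L)).
  by apply: ler_pM => //; rewrite [X in _ <= X](_ : _ = 4 * L / eps)//; rewrite /i; ring.
pose Y := i * (kR * L ^+ 2).
have Y0 : 2^-1 <= Y.
  rewrite -[X in X <= _]mulr1 /Y ler_pM ?invr_ge0// expr2 mulrA -[X in X <= _]mulr1 ler_pM//.
have YX : Y <= Y * sl by rewrite -[X in X <= _]mulr1 ler_wpM2l//; lra.
have Z1 : 2 * Num.sqrt 2 * kR * sl / (eps / 2) * L <= 6 * (Y * sl).
  have -> : 2 * Num.sqrt 2 * kR * sl / (eps / 2) * L = 4 * Num.sqrt 2 * (i * (kR * L) * sl).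
    by rewrite /i; field; rewrite lt0r_neq0.
  apply: (@le_trans _ _ (6 * (i * (kR * L) * sl))).
    by rewrite ler_wpM2r//; [rewrite !mulr_ge0//; lra|lra].
  rewrite ler_wpM2l// ler_wpM2r//; first lra.
  rewrite /Y ler_wpM2l//; first lra.
  by rewrite expr2 mulrA -[X in X <= _]mulr1 ler_wpM2l//; lra.
have -> : 100 * eps^-1 * kR * L ^+ 2 * sl = 100 * (Y * sl) by rewrite /Y /i; ring.
have X2 : h * m0 <= 12 * Y by apply: le_trans X1 _; rewrite /Y le_eqVlt; apply/orP; left; apply/eqP; ring.
lra.
Qed.

End Numeric.

(** * Lebesgue integration *)

Section LebesgueTranslation.
Variable R : realType.
Local Notation mu := (@lebesgue_measure R).

Let translation (a x : measurableTypeR R) : measurableTypeR R := x + a.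

Let measurable_translation (a : R) : measurable_fun setT (translation a).
Proof. exact: measurable_funD. Qed.

HB.instance Definition _ a := isMeasurableFun.Build _ _ _ _ (translation a) (measurable_translation a).

Let lebesgue_measure_translation (a : R) (A : set R) : measurable A ->
  pushforward mu (translation a) A = mu A.
Proof.
move=> mA; apply/esym/lebesgue_measure_unique => //= _ [[c d]] _ <-.
rewrite /pushforward /=.
have -> : translation a @^-1` `]c, d] = `]c - a, d - a]%classic.
  by apply/seteqP; split => x /=; rewrite !in_itv/= ltrBlDr lerBrDr.
rewrite !lebesgue_measure_itv/= !lte_fin ltrD2r.
by case: ifP => // _; rewrite -!EFinB; congr EFin; ring.
Qed.

Lemma ge0_integral_translation (f : R -> \bar R) (a : R) :
  measurable_fun setT f -> (forall x, 0 <= f x)%E ->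
  (\int[mu]_x f (x + a)%R = \int[mu]_x f x)%E.
Proof.
move=> mf f0.
transitivity (\int[pushforward mu (translation a)]_x f x)%E.
  by rewrite ge0_integral_pushforward.
by apply: eq_measure_integral => A mA _; exact: lebesgue_measure_translation.
Qed.

End LebesgueTranslation.

(** * Measures given by a density *)

Section Density.
Context d (T : measurableType d) (R : realType).
Variables (mu : {measure set T -> \bar R}) (g : T -> R).
Hypotheses (mg : measurable_fun setT g) (g0 : forall x, 0 <= g x).
Local Open Scope ereal_scope.
Import HBNNSimple.

(** The proofs about [g] are arguments so that the canonical measure structure can be recovered from
    the term itself. *)
Definition density_measure (_ : measurable_fun setT g) (_ : forall x, (0 <= g x)%R) (A : set T) : \bar R :=
  \int[mu]_(x in A) (g x)%:E.
Local Notation nu := (density_measure mg g0).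

Let density0 : nu set0 = 0. Proof. exact: integral_set0. Qed.

Let density_ge0 A : 0 <= nu A.
Proof. by apply: integral_ge0 => x _; rewrite lee_fin. Qed.

Let density_sigma_additive : semi_sigma_additive nu.
Proof.
move=> /= F mF tF mUF; apply: cvg_toP.
  apply: ereal_nondecreasing_is_cvgn => m n mn.
  by apply: lee_sum_nneg_natr => // k _ _; apply: integral_ge0 => x _; rewrite lee_fin.
rewrite /density_measure ge0_integral_bigcup//.
  exact/measurable_funTS/measurable_EFinP.
by move=> x _; rewrite lee_fin.
Qed.

HB.instance Definition _ := isMeasure.Build _ _ _ nu density0 density_ge0 density_sigma_additive.

Let integral_density_nnsfun (h : {nnsfun T >-> R}) :
  \int[nu]_x (h x)%:E = \int[mu]_x ((h x)%:E * (g x)%:E).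
Proof.
rewrite integralT_nnsfun sintegralE.
under [RHS]eq_integral => x _.
  rewrite fimfunE -fsumEFin// ge0_mule_fsuml; last by move=> y; rewrite EFinM nnfun_muleindic_ge0.
  over.
rewrite ge0_integral_fsum//; first last.
- by move=> y x _; apply: mule_ge0; [rewrite EFinM nnfun_muleindic_ge0|rewrite lee_fin].
- move=> y; apply: emeasurable_funM; last exact/measurable_EFinP.
  by apply/measurable_EFinP; apply: measurable_funM.
apply: eq_fsbigr => y; rewrite inE => -[t _ <-].
under [RHS]eq_integral do rewrite EFinM -muleA.
rewrite ge0_integralZl//; first last.
- by rewrite lee_fin.
- by move=> x _; rewrite mule_ge0 ?lee_fin.
- apply: emeasurable_funM; exact/measurable_EFinP.
congr (_ * _); rewrite -[LHS]/(\int[mu]_(x in h @^-1` [set h t]) (g x)%:E) integral_mkcond.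
by apply: eq_integral => x _; rewrite epatch_indic muleC.
Qed.

(** Monotone convergence along [nnsfun_approx] extends the formula from simple functions. *)
Lemma ge0_integral_density (f : T -> \bar R) : measurable_fun setT f -> (forall x, 0 <= f x) ->
  \int[nu]_x f x = \int[mu]_x (f x * (g x)%:E).
Proof.
move=> mf f0; pose h := nnsfun_approx measurableT mf.
have mh n : measurable_fun setT (fun x => (h n x)%:E) by exact/measurable_EFinP/measurable_funP.
have fE x : (h n x)%:E @[n --> \oo] --> f x by apply: cvg_nnsfun_approx => // y _.
have nd x : {homo (fun n => (h n x)%:E) : m n / (m <= n)%N >-> m <= n}.
  by move=> m n mn; rewrite lee_fin; exact/lefP/nd_nnsfun_approx.
transitivity (limn (fun n => \int[nu]_x (h n x)%:E)).
  rewrite -monotone_convergence//.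
  - by apply: eq_integral => x _; apply/esym/cvg_lim.
  - by move=> n x _; rewrite lee_fin.
transitivity (limn (fun n => \int[mu]_x ((h n x)%:E * (g x)%:E))).
  by congr (limn _); apply/funext => n; exact: integral_density_nnsfun.
rewrite -monotone_convergence//.
- apply: eq_integral => x _; apply/cvg_lim => //.
  by apply: cvgeZr.
- by move=> n; apply: emeasurable_funM => //; exact/measurable_EFinP.
- by move=> n x _; rewrite mule_ge0 ?lee_fin.
- by move=> x _ m n mn; rewrite lee_wpmul2r ?lee_fin//; exact/lefP/nd_nnsfun_approx.
Qed.

End Density.

(** * The Laplace distribution *)

Section Laplace.
Variable R : realType.
Local Notation mu := (@lebesgue_measure R).
Implicit Types m s x a : R.

Lemma laplace_pdf_ge0 m s x : 0 < s -> 0 <= laplace_pdf m s x.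
Proof. by move=> s0; rewrite mulr_ge0 ?expR_ge0// invr_ge0 mulr_ge0// ltW. Qed.

Lemma continuous_laplace_pdf m s : continuous (laplace_pdf m s).
Proof.
move=> x; apply: cvgM; first exact: cvg_cst.
apply: (cvg_comp _ expR); last exact: continuous_expR.
apply: cvgM; last exact: cvg_cst.
apply: (@cvgN _ R^o).
apply: (cvg_comp (fun x => x - m) Num.norm); last exact: norm_continuous.
by apply: (@cvgB _ R^o); [exact: cvg_id|exact: cvg_cst].
Qed.

Lemma measurable_laplace_pdf m s : measurable_fun setT (laplace_pdf m s).
Proof. by apply: continuous_measurable_fun => x; exact: continuous_laplace_pdf. Qed.

Lemma emeasurable_laplace_pdf m s (D : set R) : measurable_fun D (fun x => (laplace_pdf m s x)%:E).
Proof. by apply: measurable_funTS; apply/measurable_EFinP; exact: measurable_laplace_pdf. Qed.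

Lemma laplace_pdf_translation m s a x : laplace_pdf m s (x + a) = laplace_pdf (m - a) s x.
Proof. by rewrite /laplace_pdf opprB addrA. Qed.

(** An antiderivative of the density: left of [m] for [b = 1], right of [m] for [b = -1]. A symbolic
    [b] treats both branches at once. *)
Let P m s (b x : R) : R := b / 2 * expR ((x - m) * (b / s)).

Let is_deriveP m s b x : is_derive x 1 (P m s b) (b ^+ 2 / (2 * s) * expR ((x - m) * (b / s))).
Proof.
have h : is_derive (x : R^o) 1 (fun x : R^o => (x - m) * (b / s)) (b / s).
  rewrite (_ : (fun x => _) = (b / s) \*: (@id R^o - cst m)); last first.
    by apply/funext => y; rewrite /= mulrC.
  have := @is_deriveZ R R^o R^o (@id R^o - cst m) (b / s) x 1 1.
  rewrite /GRing.scale/= mulr1; apply.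
  by rewrite -[X in is_derive _ _ _ X]subr0; apply: is_deriveB.
have := is_deriveZ (b / 2) (@is_derive1_comp R expR (fun x => (x - m) * (b / s)) x _ _ (is_derive_expR _) h).
rewrite /GRing.scale /= => h2.
apply: (is_derive_eq h2); rewrite invfM; ring.
Qed.

Let continuousP m s b : continuous (P m s b).
Proof.
move=> x; apply/differentiable_continuous/derivable1_diffP.
exact: (@ex_derive _ _ _ _ _ _ _ (is_deriveP m s b x)).
Qed.

Let integralP m s b u v : u < v -> (forall x, u < x < v -> laplace_pdf m s x = b ^+ 2 / (2 * s) * expR ((x - m) * (b / s))) ->
  (\int[mu]_(x in `[u, v]) (laplace_pdf m s x)%:E = (P m s b v - P m s b u)%:E)%E.
Proof.
move=> uv fE; rewrite EFinB; apply: continuous_FTC2 => //.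
- exact/continuous_subspaceT/continuous_laplace_pdf.
- split=> [x _| |].
  + exact: (@ex_derive _ _ _ _ _ _ _ (is_deriveP m s b x)).
  + exact/cvg_at_right_filter/continuousP.
  + exact/cvg_at_left_filter/continuousP.
- move=> x; rewrite in_itv/= => xuv.
  by rewrite derive1E (@derive_val _ _ _ _ _ _ _ (is_deriveP m s b x)) fE.
Qed.

Let left_pdf m s x : x <= m -> laplace_pdf m s x = 1 ^+ 2 / (2 * s) * expR ((x - m) * (1 / s)).
Proof.
move=> xm; rewrite /laplace_pdf ler0_norm ?subr_le0// opprK.
by rewrite expr1n !div1r.
Qed.

Let right_pdf m s x : m <= x -> laplace_pdf m s x = (-1) ^+ 2 / (2 * s) * expR ((x - m) * (-1 / s)).
Proof.
move=> mx; rewrite /laplace_pdf ger0_norm ?subr_ge0// sqrrN expr1n div1r.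
by congr (_ * expR _); rewrite !mulNr mulrN div1r.
Qed.

(** The interval is symmetric about [m]; each half contributes (1 - exp(-m/s)) / 2. Noise centered
    at m = s ln(1/beta) thus leaves it with probability beta. *)
Lemma integral_laplace_pdf_itv m s : 0 < s -> 0 < m ->
  (\int[mu]_(x in `[0%R, (2 * m)%R]) (laplace_pdf m s x)%:E = (1 - expR (- (m / s)))%:E)%E.
Proof.
move=> s0 m0.
rewrite (@itv_bndbnd_setU _ R _ (BRight m)); last 2 first.
  by rewrite bnd_simp ltW.
  by rewrite bnd_simp; lra.
rewrite ge0_integral_setU//=; first last.
- apply/disj_setPRL => x /=; rewrite !in_itv/= => /andP[mx _].
  by apply/negP; rewrite negb_and -!ltNge mx orbT.
- by move=> x _; rewrite lee_fin laplace_pdf_ge0.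
- exact: emeasurable_laplace_pdf.
rewrite integral_itv_obnd_cbnd; last exact: emeasurable_laplace_pdf.
rewrite (@integralP _ _ 1)//; last by move=> x /andP[_ /ltW]; exact: left_pdf.
rewrite (@integralP _ _ (-1)); last 2 first.
  lra.
  by move=> x /andP[/ltW mx _]; exact: right_pdf.
rewrite -EFinD; congr EFin; rewrite /P subrr !mul0r expR0 !mulr1.
rewrite (_ : (0 - m) * (1 / s) = - (m / s)); last by field; exact: lt0r_neq0.
rewrite (_ : (2 * m - m) * (-1 / s) = - (m / s)); last by field; exact: lt0r_neq0.
by field.
Qed.

(** Translation centers the density at 0, and evenness reduces the integral to a half-line. *)
Lemma integral_laplace_pdf m s : 0 < s -> (\int[mu]_x (laplace_pdf m s x)%:E = 1)%E.
Proof.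
move=> s0.
rewrite -(@ge0_integral_translation _ _ m); first last.
- by move=> x; rewrite lee_fin laplace_pdf_ge0.
- exact: emeasurable_laplace_pdf.
under eq_integral do rewrite laplace_pdf_translation subrr.
rewrite ge0_symfun_integralT; first last.
- by move=> x; rewrite /laplace_pdf /= !subr0 normrN.
- exact: continuous_laplace_pdf.
- by move=> x; rewrite laplace_pdf_ge0.
rewrite (_ : [set x | 0 <= x] = `[0, +oo[%classic :> set R); last first.
  by apply/seteqP; split => x /=; rewrite in_itv/= andbT.
rewrite (@ge0_continuous_FTC2y _ _ (P 0 s (-1)) 0 0).
- rewrite /P subrr mul0r expR0 -EFinB -EFinM; congr EFin; by field.
- by move=> x _; rewrite laplace_pdf_ge0.
- exact/continuous_subspaceT/continuous_laplace_pdf.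
- rewrite -[X in _ --> X](mulr0 (-1 / 2)).
  apply: cvgM; first exact: cvg_cst.
  have -> : (fun x : R => expR ((x - 0) * (-1 / s))) = (fun z => expR (- z)) \o (fun z => s^-1 * z).
    by apply/funext => x /=; congr expR; rewrite subr0 mulrC !mulNr div1r.
  apply: (@cvg_comp _ _ _ _ _ _ (pinfty_nbhs R)); last exact: cvgr_expR.
  by apply: gt0_cvgMry => //; rewrite invr_gt0.
- by move=> x _; exact: (@ex_derive _ _ _ _ _ _ _ (is_deriveP 0 s (-1) x)).
- exact/cvg_at_right_filter/continuousP.
- move=> x; rewrite in_itv/= andbT => x0.
  by rewrite derive1E (@derive_val _ _ _ _ _ _ _ (is_deriveP 0 s (-1) x)) right_pdf// ltW.
Qed.

(** The total mass 1 bounds the integral, hence [fine] loses nothing. *)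
Lemma laplace_probE m s (B : set R) : 0 < s -> measurable B ->
  ((laplace_prob m s B)%:E = \int[mu]_(x in B) (laplace_pdf m s x)%:E)%E.
Proof.
move=> s0 mB; rewrite fineK// ge0_fin_numE; last first.
  by apply: integral_ge0 => x _; rewrite lee_fin laplace_pdf_ge0.
apply: (@le_lt_trans _ _ 1%E); last exact: ltry.
rewrite -(integral_laplace_pdf m s0); apply: ge0_subset_integral => //.
- exact: emeasurable_laplace_pdf.
- by move=> x _; rewrite lee_fin laplace_pdf_ge0.
Qed.

Lemma laplace_probT m s : 0 < s -> laplace_prob m s setT = 1.
Proof. by move=> s0; rewrite /laplace_prob integral_laplace_pdf. Qed.

Lemma laplace_prob_itv m s : 0 < s -> 0 < m ->
  laplace_prob m s `[0, 2 * m] = 1 - expR (- (m / s)).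
Proof. by move=> s0 m0; rewrite /laplace_prob integral_laplace_pdf_itv. Qed.

Lemma laplace_prob_ge0 m s (B : set R) : 0 < s -> 0 <= laplace_prob m s B.
Proof.
by move=> s0; apply: fine_ge0; apply: integral_ge0 => x _; rewrite lee_fin laplace_pdf_ge0.
Qed.

End Laplace.

(** * Shifts of independent Laplace noise *)

Section Boxes.
Context d (Omega : measurableType d) (R : realType) (I : finType).
Local Notation T := (g_sigma_algebraType (@boxes R I)).

Lemma boxes_setT : @boxes R I setT.
Proof. by exists (fun=> setT); split=> //; apply/seteqP; split. Qed.

(** Boxes form a pi-system, so finite measures that agree on them are equal. *)
Lemma boxes_setI : setI_closed (@boxes R I).
Proof.
move=> _ _ [B [mB ->]] [C [mC ->]]; exists (fun i => B i `&` C i); split.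
  by move=> i; exact: measurableI.
by apply/seteqP; split => x /= => [[h1 h2] i|h]; [split|split=> i; case: (h i)].
Qed.

Lemma measurable_coord (i : I) : measurable_fun setT (fun x : T => x i).
Proof.
move=> _ B mB; rewrite setTI; apply: sub_sigma_algebra.
exists (fun j => if j == i then B else setT); split.
  by move=> j; case: ifP.
apply/seteqP; split=> x /= => [Bx j|/(_ i)]; last by rewrite eqxx.
by case: ifP => // /eqP ->.
Qed.

Lemma measurable_fun_boxes (Y : Omega -> T) :
  (forall i, measurable_fun setT (fun om => Y om i)) -> measurable_fun setT Y.
Proof.
move=> mY; have := @measurability _ _ Omega T setT Y (@boxes R I) erefl; apply.
move=> _ [_ [B [mB ->]] <-]; rewrite setTI.
rewrite (_ : _ @^-1` _ = \bigcap_(i in [set: I]) ((fun om => Y om i) @^-1` B i)); last first.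
  by apply/seteqP; split => om /= => [h i _|h i]; exact: h.
apply: fin_bigcap_measurable => // i _.
by rewrite -[X in measurable X]setTI; exact: mY.
Qed.

End Boxes.

(** * Change of centers for independent Laplace noise *)

Section ShiftedNoise.
Context d (Omega : measurableType d) (R : realType) (P : probability Omega R) (I : finType).
Variables (A : set Omega) (X : I -> Omega -> R) (m s : I -> R) (p : R).
Hypotheses (mA : measurable A) (mX : forall i, measurable_fun setT (X i)).
Hypotheses (s0 : forall i, 0 < s i) (p0 : 0 <= p).
(** [A] will be the event [V1 = S] and [p] its probability. Restricting [P] to [A] without
    normalising avoids dividing by a probability that may vanish. *)
Hypothesis law : forall B : I -> set R, (forall i, measurable (B i)) ->
  P (A `&` [set om | forall i, B i (X i om)]) = (p * \prod_i laplace_prob (m i) (s i) (B i))%:E.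
Local Notation T := (g_sigma_algebraType (@boxes R I)).
Local Notation PA := (mrestr P mA).
Implicit Types (c : I -> R).

Definition noisy c (om : Omega) : T := fun i => X i om + c i.

Lemma measurable_noisy c : measurable_fun setT (noisy c).
Proof. by apply: measurable_fun_boxes => i; exact: measurable_funD. Qed.

(* The logarithm of the density ratio at y of the laws of X_j + c_j and X_j + c'_j. *)
Definition loss c c' (j : I) (y : R) : R :=
  (`|y - (m j + c' j)| - `|y - (m j + c j)|) / s j.

Lemma measurable_loss c c' j : measurable_fun setT (loss c c' j).
Proof.
apply: measurable_funM => //; apply: measurable_funB;
  by apply: measurableT_comp => //; exact: measurable_funB.
Qed.

Lemma normr_loss_le c c' j y : `|loss c c' j y| <= `|c j - c' j| / s j.
Proof.
rewrite normrM [X in _ * X]gtr0_norm ?invr_gt0// ler_pM2r ?invr_gt0//.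
apply: le_trans (ler_dist_dist _ _) _.
by rewrite (_ : _ - _ = c j - c' j)//; ring.
Qed.

Lemma laplace_pdf_loss c c' j y :
  laplace_pdf (m j) (s j) (y - c' j) * expR (loss c c' j y) = laplace_pdf (m j) (s j) (y - c j).
Proof.
have e z : y - z - m j = y - (m j + z) by ring.
by rewrite /laplace_pdf -mulrA -expRD !e /loss; congr (_ * expR _); ring.
Qed.

Let laplace_shift j (a : R) (B : set R) : measurable B ->
  ((laplace_prob (m j) (s j) [set x | B (x + a)%R])%:E =
   \int[lebesgue_measure]_x (\1_B x * laplace_pdf (m j) (s j) (x - a))%:E)%E.
Proof.
move=> mB.
have mBa : measurable [set x : R | B (x + a)].
  by rewrite -[X in measurable X]setTI; apply: measurable_funD.
rewrite laplace_probE// integral_mkcond.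
rewrite -[RHS](@ge0_integral_translation _ _ a); first last.
- by move=> x; rewrite lee_fin mulr_ge0 ?laplace_pdf_ge0.
- apply/measurable_EFinP; apply: measurable_funM => //.
  apply: measurableT_comp; first exact: measurable_laplace_pdf.
  exact: measurable_funB.
apply: eq_integral => x _.
rewrite epatch_indic /= addrK muleC -EFinM; congr (_ * _)%:E.
Qed.

(** By independence, confining the other coordinates to a box only contributes a constant factor,
    and [X j] keeps its Laplace density. *)
Let integral_coord j (B : I -> set R) (h : R -> \bar R) : (forall i, measurable (B i)) ->
  measurable_fun setT h -> (forall y, 0 <= h y)%E ->
  (\int[PA]_(om in [set om | forall i, i != j -> B i (X i om)]) h (X j om) =
   \int[lebesgue_measure]_y (h y * ((p * \prod_(i | i != j) laplace_prob (m i) (s i) (B i)) *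
      laplace_pdf (m j) (s j) y)%:E))%E.
Proof.
move=> mB mh h0; set D := [set om | _]; set K := p * _.
have K0 : 0 <= K by rewrite mulr_ge0// prodr_ge0// => i _; exact: laplace_prob_ge0.
have mX' i (C : set R) : measurable C -> measurable [set om | C (X i om)].
  by move=> mC; rewrite -[X in measurable X]setTI; exact: mX.
have mD : measurable D.
  rewrite (_ : D = \bigcap_(i in [set i | i != j]) [set om | B i (X i om)]).
    by apply: fin_bigcap_measurable => [|i _]; [exact: finite_finset|exact: mX'].
  by apply/seteqP; split => om.
pose PAD := mrestr PA mD.
(* The restriction to [D] moves from the domain into the measure, so that the push-forward along
   [X j] is defined on the whole space. *)
have -> : (\int[PA]_(om in D) h (X j om) = \int[PAD]_om h (X j om))%E.
  transitivity (\int[PAD]_(om in D) h (X j om))%E.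
    apply: eq_measure_integral => C mC CD.
    by rewrite -[RHS]/(PA (C `&` D)) setIidl.
  rewrite [RHS](@ge0_negligible_integral _ _ _ PAD setT (~` D))//.
  - by rewrite setTD setCK.
  - exact: measurableC.
  - exact: measurableT_comp.
  - by rewrite -[LHS]/(PA (~` D `&` D)) setICl measure0.
have mXj : measurable_fun setT (X j : Omega -> measurableTypeR R) by exact: mX.
pose f : {mfun Omega >-> measurableTypeR R} := HB.pack (X j : Omega -> measurableTypeR R) (isMeasurableFun.Build _ _ _ _ _ mXj).
transitivity (\int[pushforward PAD f]_y h y)%E.
  by rewrite ge0_integral_pushforward.
have mg : measurable_fun setT (fun y => K * laplace_pdf (m j) (s j) y).
  by apply: measurable_funM => //; exact: measurable_laplace_pdf.
have g0 y : 0 <= K * laplace_pdf (m j) (s j) y by rewrite mulr_ge0 ?laplace_pdf_ge0.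
rewrite -(@ge0_integral_density _ _ _ lebesgue_measure _ mg g0 h mh h0).
apply: eq_measure_integral => C mC _.
rewrite -[RHS]/(\int[lebesgue_measure]_(x in C) (K * laplace_pdf (m j) (s j) x)%:E)%E.
under [RHS]eq_integral do rewrite EFinM.
rewrite ge0_integralZl//; first last.
- by move=> x _; rewrite lee_fin laplace_pdf_ge0.
- exact: emeasurable_laplace_pdf.
rewrite -laplace_probE// -EFinM /K -mulrA [\prod_(i | _) _ * _]mulrC.
(* The box with [C] in coordinate [j], to which [law] applies. *)
pose B' i := if i == j then C else B i.
have -> : laplace_prob (m j) (s j) C * \prod_(i | i != j) laplace_prob (m i) (s i) (B i) =
    \prod_i laplace_prob (m i) (s i) (B' i).
  rewrite [RHS](bigD1 j)//= /B' eqxx; congr (_ * _).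
  by apply: eq_bigr => i /negbTE ->.
rewrite -law; last by move=> i; rewrite /B'; case: ifP.
rewrite -[LHS]/(P ((X j @^-1` C `&` D) `&` A)); congr (P _).
apply/seteqP; split => om /=.
  move=> [[Cj Di] Aom]; split=> // i; rewrite /B'; case: eqP => [->//|/eqP]; exact: Di.
move=> [Aom h']; split=> //; split; first by have := h' j; rewrite /B' eqxx.
by move=> i ij; have := h' i; rewrite /B' (negbTE ij).
Qed.

(** Both sides integrate [F] against a measure on [T]: the law of [noisy c], and the law of
    [noisy c'] with density exp(loss). These agree on boxes, where only coordinate [j] has to be
    compared, hence everywhere. *)
Lemma ge0_integral_change_coord c c' j (F : T -> \bar R) :
  (forall i, i != j -> c i = c' i) ->
  measurable_fun setT F -> (forall x, 0 <= F x)%E ->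
  (\int[PA]_om F (noisy c om) =
   \int[PA]_om (F (noisy c' om) * (expR (loss c c' j (noisy c' om j)))%:E))%E.
Proof.
move=> cc' mF F0.
pose f c : {mfun Omega >-> T} :=
  HB.pack (noisy c) (isMeasurableFun.Build _ _ _ _ _ (measurable_noisy c)).
pose g (x : T) := expR (loss c c' j (x j)).
have mg : measurable_fun setT g.
  apply: measurableT_comp => //; apply: (measurableT_comp (measurable_loss c c' j)).
  exact: measurable_coord.
have g0 x : 0 <= g x by exact: expR_ge0.
rewrite -[LHS]/(\int[PA]_om (F \o noisy c) om)%E.
rewrite -[RHS]/(\int[PA]_om ((fun x => F x * (g x)%:E) \o noisy c') om)%E.
rewrite -(@ge0_integral_pushforward _ _ _ _ _ _ (measurable_noisy c) PA setT)//.
rewrite -(@ge0_integral_pushforward _ _ _ _ _ _ (measurable_noisy c') PA setT)//; first last.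
- by move=> x _; rewrite mule_ge0 ?lee_fin.
- by apply: emeasurable_funM => //; exact/measurable_EFinP.
rewrite -[LHS]/(\int[pushforward PA (f c)]_x F x)%E.
rewrite -[RHS]/(\int[pushforward PA (f c')]_x (F x * (g x)%:E))%E.
rewrite -(@ge0_integral_density _ _ _ (pushforward PA (f c')) _ mg g0 F mF F0).
apply: eq_measure_integral => E mE _.
apply: (@measure_unique _ _ T (@boxes R I) (fun=> setT)) => //.
- exact: boxes_setI.
- by move=> _; exact: boxes_setT.
- by rewrite bigcup_const.
- move=> _ [B [mB ->]].
  transitivity (P (A `&` [set om | forall i, [set y | B i (y + c i)] (X i om)])).
    by rewrite setIC.
  have mBs i a : measurable [set y : R | B i (y + a)].
    by rewrite -[X in measurable X]setTI; apply: measurable_funD.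
  rewrite (@law (fun i => [set y | B i (y + c i)])); last by move=> i; exact: mBs.
  rewrite (bigD1 j)//= mulrCA EFinM laplace_shift//.
  rewrite -[RHS]/(\int[pushforward PA (f c')]_(x in [set x | forall i, B i (x i)]) (g x)%:E)%E.
  rewrite ge0_integral_pushforward//; first last.
  + by move=> x _; rewrite lee_fin.
  + exact/measurable_funTS/measurable_EFinP.
  + by apply: sub_sigma_algebra; exists B.
  (* The constraint on coordinate [j] becomes an indicator in the integrand; the remaining
     constraints form the domain required by [integral_coord]. *)
  pose h y : \bar R := (\1_(B j) (y + c' j) * expR (loss c c' j (y + c' j)))%:E.
  have h0 y : (0 <= h y)%E by rewrite lee_fin mulr_ge0 ?expR_ge0.
  have mshift : measurable_fun setT (fun y : R => y + c' j) by exact: measurable_funD.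
  have mh : measurable_fun setT h.
    apply/measurable_EFinP; apply: measurable_funM.
      exact: (measurableT_comp (measurable_indic (mB j))).
    apply: measurableT_comp => //.
    exact: (measurableT_comp (measurable_loss c c' j)).
  pose B' i := [set y | B i (y + c' i)].
  transitivity (\int[PA]_(om in [set om | forall i, i != j -> B' i (X i om)]) h (X j om))%E; last first.
    rewrite [LHS]integral_mkcond [RHS]integral_mkcond; apply: eq_integral => om _.
    rewrite !epatch_indic /= /h -!EFinM; congr EFin.
    rewrite -/(noisy c' om j) /g mulrAC [RHS]mulrC; congr (_ * _).
    rewrite !indicE -natrM mulnb; congr (nat_of_bool _)%:R.
    apply/andP/idP; rewrite !inE /=.
      by move=> [h1 h2] i; have [->//|/h2] := eqVneq i j.
    by move=> h1; split=> [|i _]; exact: h1.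
  rewrite integral_coord//; last by move=> i; exact: mBs.
  set K := p * _; set K' := p * _.
  have -> : K' = K.
    by congr (_ * _); apply: eq_bigr => i ij; rewrite (cc' _ ij).
  have K0 : 0 <= K by rewrite mulr_ge0// prodr_ge0// => i _; exact: laplace_prob_ge0.
  rewrite -(@ge0_integral_translation _ _ (c' j)); first last.
  + by move=> x; rewrite lee_fin mulr_ge0 ?laplace_pdf_ge0.
  + apply/measurable_EFinP; apply: measurable_funM => //.
    apply: measurableT_comp; first exact: measurable_laplace_pdf.
    exact: measurable_funB.
  transitivity (\int[lebesgue_measure]_y
      (K%:E * (\1_(B j) (y + c' j) * laplace_pdf (m j) (s j) (y + c' j - c j))%:E))%E.
    rewrite ge0_integralZl//; first by rewrite muleC.
    - apply/measurable_EFinP; apply: measurable_funM.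
        exact: (measurableT_comp (measurable_indic (mB j))).
      apply: measurableT_comp; first exact: measurable_laplace_pdf.
      exact: measurable_funB.
    - by move=> x _; rewrite lee_fin mulr_ge0 ?laplace_pdf_ge0.
  apply: eq_integral => y _; rewrite /h -!EFinM; congr EFin.
  by rewrite -(laplace_pdf_loss c c') addrK; ring.
- move=> k; apply: (@le_lt_trans _ _ 1%E); last exact: ltry.
  by have := probability_le1 P mA; rewrite -{1}[A]setTI; exact.
Qed.

(** Hybrid centers, for passing from [c'] to [c] one coordinate at a time. *)
Let mix c c' (q : seq I) : I -> R := fun i => if i \in q then c i else c' i.

Let measurable_sum_loss c c' (q : seq I) :
  measurable_fun setT (fun x : T => \sum_(j <- q) loss c c' j (x j)).
Proof.
elim: q => [|j q IH].
  by rewrite (_ : (fun _ => _) = cst 0) //; apply/funext => x; rewrite big_nil.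
rewrite (_ : (fun _ => _) = (fun x : T => loss c c' j (x j) + \sum_(j <- q) loss c c' j (x j))).
  apply: measurable_funD => //; apply: (measurableT_comp (measurable_loss c c' j)).
  exact: measurable_coord.
by apply/funext => x; rewrite big_cons.
Qed.

Lemma ge0_integral_change c c' (q : seq I) (F : T -> \bar R) :
  uniq q -> (forall i, i \notin q -> c i = c' i) ->
  measurable_fun setT F -> (forall x, 0 <= F x)%E ->
  (\int[PA]_om F (noisy c om) =
   \int[PA]_om (F (noisy c' om) *
     (expR (\sum_(j <- q) loss c c' j (noisy c' om j)))%:E))%E.
Proof.
move=> uq cc'; have -> : c = mix c c' q.
  by apply/funext => i; rewrite /mix; case: ifPn => // /cc'.
have -> : (fun om => F (noisy c' om) * (expR (\sum_(j <- q) loss (mix c c' q) c' j (noisy c' om j)))%:E)%E =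
    (fun om => F (noisy c' om) * (expR (\sum_(j <- q) loss c c' j (noisy c' om j)))%:E)%E.
  apply/funext => om; congr (_ * (expR _)%:E)%E; apply: eq_big_seq => j jq.
  by rewrite /loss /mix jq.
elim: q uq F {cc'} => [_|j q IH /= /andP[jq uq]] F mF F0.
  rewrite (_ : mix c c' [::] = c'); last exact/funext.
  by apply: eq_integral => om _; rewrite big_nil expR0 mule1.
rewrite (@ge0_integral_change_coord (mix c c' (j :: q)) (mix c c' q) j F _ mF F0); last first.
  by move=> i ij; rewrite /mix inE (negbTE ij).
(* The density factor of coordinate [j] is absorbed into the integrand before the induction
   hypothesis is applied to the rest. *)
pose G (x : T) := (F x * (expR (loss c c' j (x j)))%:E)%E.
have mG : measurable_fun setT G.
  apply: emeasurable_funM => //; apply/measurable_EFinP; apply: measurableT_comp => //.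
  by apply: (measurableT_comp (measurable_loss c c' j)); exact: measurable_coord.
have G0 x : (0 <= G x)%E by rewrite mule_ge0 ?lee_fin ?expR_ge0.
transitivity (\int[PA]_om G (noisy (mix c c' q) om))%E.
  apply: eq_integral => om _; rewrite /G; congr (_ * (expR _)%:E)%E.
  by rewrite /loss /mix inE eqxx /= (negbTE jq).
rewrite (IH uq G mG G0); apply: eq_integral => om _.
by rewrite /G -muleA -EFinM -expRD big_cons.
Qed.

(** Each coordinate costs a factor exp(2 (a t)^2). The chord bounds exp(a loss_j) by M + B
    (exp(loss_j) - 1), and the B part integrates to 0: exp(loss_j) is a density ratio in coordinate
    [j], on which the other factors do not depend. *)
Lemma integral_expR_sum_loss_le c c' (q : seq I) (a t : R) :
  uniq q -> 1 <= a -> 0 < t -> (forall j, j \in q -> `|c j - c' j| / s j <= t) ->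
  (\int[PA]_om (expR (a * \sum_(j <- q) loss c c' j (noisy c' om j)))%:E <=
   (expR (2 * (a * t) ^+ 2 * (size q)%:R))%:E * P A)%E.
Proof.
move=> uq a1 t0; elim: q uq => [_ _|j q IH /= /andP[jq uq] ct].
  under eq_integral do rewrite big_nil mulr0 expR0.
  rewrite integral_cst// mulr0 expR0 !mul1e.
  by rewrite -[X in (X <= _)%E]/(P (setT `&` A)) setTI.
have {}IH := IH uq (fun i iq => ct i (@mem_behead _ (j :: q) i iq)).
pose G (x : T) := (expR (a * \sum_(j <- q) loss c c' j (x j)))%:E.
have mG : measurable_fun setT G.
  apply/measurable_EFinP; apply: measurableT_comp => //; apply: measurable_funM => //.
have G0 x : (0 <= G x)%E by rewrite lee_fin expR_ge0.
have [B B0 chord] := expR_chord a1 t0.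
set M := expR (2 * (a * t) ^+ 2) in chord.
have mn : measurable_fun setT (noisy c') := measurable_noisy c'.
have mGn : measurable_fun setT (fun om => G (noisy c' om)) by exact: measurableT_comp.
have ml : measurable_fun setT (fun om => loss c c' j (noisy c' om j)).
  apply: (measurableT_comp (measurable_loss c c' j)).
  exact: (measurableT_comp (measurable_coord _) mn).
set S := (\int[PA]_om G (noisy c' om))%E in IH.
have S0 : (0 <= S)%E by exact: integral_ge0.
have Sfin : (S \is a fin_num).
  rewrite ge0_fin_numE//; apply: le_lt_trans IH _.
  apply: (@le_lt_trans _ _ ((expR (2 * (a * t) ^+ 2 * (size q)%:R))%:E * 1)%E).
    by rewrite lee_wpmul2l ?lee_fin ?expR_ge0// probability_le1.
  by rewrite mule1 ltry.
have Sj : (\int[PA]_om (G (noisy c' om) * (expR (loss c c' j (noisy c' om j)))%:E) = S)%E.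
  (* Changing the center of coordinate [j] alone realises the factor exp(loss_j). *)
  pose cj i := if i == j then c i else c' i.
  transitivity (\int[PA]_om G (noisy cj om))%E.
    rewrite (@ge0_integral_change_coord cj c' j G _ mG G0); last by move=> i /negbTE; rewrite /cj => ->.
    by apply: eq_integral => om _; congr (_ * (expR _)%:E)%E; rewrite /loss /cj eqxx.
  apply: eq_integral => om _; congr (expR (a * _))%:E.
  apply: eq_big_seq => i iq; rewrite /noisy /cj.
  by have [ij|//] := eqVneq i j; rewrite -ij iq in jq.
(* [B * S] is added on both sides instead of being subtracted; it cancels afterwards because [S] is
   finite. *)
have key : (\int[PA]_om (expR (a * \sum_(i <- j :: q) loss c c' i (noisy c' om i)))%:E + B%:E * S
    <= M%:E * S + B%:E * S)%E.
  rewrite -{3}Sj -!ge0_integralZl ?lee_fin ?expR_ge0//; first last.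
  - by move=> om _; rewrite mule_ge0 ?lee_fin ?expR_ge0.
  - apply: emeasurable_funM => //; apply/measurable_EFinP; exact: measurableT_comp.
  have mexp : measurable_fun setT (fun om => (expR (a * \sum_(i <- j :: q) loss c c' i (noisy c' om i)))%:E).
    apply/measurable_EFinP; apply: measurableT_comp => //; apply: measurable_funM => //.
    exact: (measurableT_comp (measurable_sum_loss c c' (j :: q)) mn).
  have mBG : measurable_fun setT (fun om => B%:E * G (noisy c' om))%E by exact: emeasurable_funM.
  have mMG : measurable_fun setT (fun om => M%:E * G (noisy c' om))%E by exact: emeasurable_funM.
  have mBGe : measurable_fun setT
      (fun om => B%:E * (G (noisy c' om) * (expR (loss c c' j (noisy c' om j)))%:E))%E.
    by apply: emeasurable_funM => //; apply: emeasurable_funM => //; apply/measurable_EFinP; exact: measurableT_comp.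
  have BG0 om : [set: Omega] om -> (0 <= B%:E * G (noisy c' om))%E by rewrite mule_ge0 ?lee_fin.
  have MG0 om : [set: Omega] om -> (0 <= M%:E * G (noisy c' om))%E.
    by rewrite mule_ge0 ?lee_fin ?expR_ge0.
  have BGe0 om : [set: Omega] om ->
      (0 <= B%:E * (G (noisy c' om) * (expR (loss c c' j (noisy c' om j)))%:E))%E.
    by rewrite !mule_ge0 ?lee_fin ?expR_ge0.
  have e0 om : [set: Omega] om ->
      (0 <= (expR (a * \sum_(i <- j :: q) loss c c' i (noisy c' om i)))%:E)%E.
    by rewrite lee_fin expR_ge0.
  rewrite -!ge0_integralD//; apply: ge0_le_integral => //.
  - by move=> om _; rewrite adde_ge0 ?BG0 ?e0.
  - exact: emeasurable_funD.
  - exact: emeasurable_funD.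
  move=> om _; rewrite /G -!EFinM -!EFinD lee_fin big_cons mulrDr expRD.
  set g := expR (a * \sum_(i <- q) _); set l := loss _ _ _ _.
  have g0 : 0 <= g by exact: expR_ge0.
  have := chord l (le_trans (normr_loss_le _ _ _ _) (ct j (mem_head _ _))).
  by move=> h; have := ler_wpM2l g0 h; lra.
have {key} : (\int[PA]_om (expR (a * \sum_(i <- j :: q) loss c c' i (noisy c' om i)))%:E <= M%:E * S)%E.
  by rewrite leeD2rE// in key; rewrite fin_numM.
move=> /le_trans; apply.
apply: (@le_trans _ _ (M%:E * ((expR (2 * (a * t) ^+ 2 * (size q)%:R))%:E * P A))%E).
  by rewrite lee_wpmul2l// lee_fin expR_ge0.
rewrite muleA -EFinM -expRD lee_wpmul2r ?measure_ge0// lee_fin ler_expR.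
by rewrite /= -[(size q).+1%:R]natr1 [X in _ <= X]mulrDr mulr1 addrC.
Qed.

Let measurable_event c (O : set T) : measurable O -> measurable (noisy c @^-1` O).
Proof. by move=> mO; rewrite -[X in measurable X]setTI; exact: measurable_noisy. Qed.

Let probE c (O : set T) : measurable O ->
  P (A `&` noisy c @^-1` O) = (\int[PA]_om (\1_O (noisy c om))%:E)%E.
Proof.
move=> mO; rewrite -[RHS]/(\int[PA]_om (\1_(noisy c @^-1` O) om)%:E)%E.
rewrite integral_indic//; last exact: measurable_event.
by rewrite setIT -[RHS]/(P (noisy c @^-1` O `&` A)) setIC.
Qed.

Let measurable_indicE (O : set T) : measurable O -> measurable_fun setT (fun x : T => (\1_O x)%:E : \bar R).
Proof. by move=> mO; apply/measurable_EFinP; exact: measurable_indic. Qed.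

(** The density ratio is pointwise at most exp e, since each loss is bounded by the shift over the
    scale. *)
Lemma noisy_pure_dp c c' (O : set T) (e : R) : measurable O ->
  \sum_i `|c i - c' i| / s i <= e ->
  (P (A `&` noisy c @^-1` O) <= (expR e)%:E * P (A `&` noisy c' @^-1` O))%E.
Proof.
move=> mO ce; rewrite !probE//.
rewrite (@ge0_integral_change c c' (index_enum I) (fun x => (\1_O x)%:E)); first last.
- by move=> x; rewrite lee_fin.
- exact: measurable_indicE.
- by move=> i; rewrite mem_index_enum.
- exact: index_enum_uniq.
have mi : measurable_fun setT (fun om => (\1_O (noisy c' om))%:E : \bar R).
  exact: (measurableT_comp (measurable_indicE mO) (measurable_noisy c')).
rewrite -ge0_integralZl ?lee_fin ?expR_ge0//.
apply: ge0_le_integral => //.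
- apply: emeasurable_funM => //; apply/measurable_EFinP; apply: measurableT_comp => //.
  exact: (measurableT_comp (measurable_sum_loss c c' _) (measurable_noisy c')).
- exact: emeasurable_funM.
move=> om _; rewrite muleC lee_wpmul2r ?lee_fin// ler_expR; apply: le_trans ce.
by apply: ler_sum => i _; apply: le_trans (ler_norm _) (normr_loss_le _ _ _ _).
Qed.

(* [l] is the order (minus one) of the exponential moment of the privacy loss used in the tail bound. *)
Lemma noisy_approx_dp c c' (O : set T) (J : {set I}) (e l t : R) : measurable O ->
  0 < l -> 0 < t -> (forall i, i \notin J -> c i = c' i) ->
  (forall i, i \in J -> `|c i - c' i| / s i <= t) ->
  (P (A `&` noisy c @^-1` O) <= (expR e)%:E * P (A `&` noisy c' @^-1` O) +
     (expR (2 * ((1 + l) * t) ^+ 2 * #|J|%:R - l * e))%:E * P A)%E.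
Proof.
move=> mO l0 t0 cc' ct; rewrite !probE//.
rewrite (@ge0_integral_change c c' (enum J) (fun x => (\1_O x)%:E) (enum_uniq _)); first last.
- by move=> x; rewrite lee_fin.
- exact: measurable_indicE.
- by move=> i; rewrite mem_enum; exact: cc'.
have mi : measurable_fun setT (fun om => (\1_O (noisy c' om))%:E : \bar R).
  exact: (measurableT_comp (measurable_indicE mO) (measurable_noisy c')).
have mL : measurable_fun setT (fun om => \sum_(j <- enum J) loss c c' j (noisy c' om j)).
  exact: (measurableT_comp (measurable_sum_loss c c' _) (measurable_noisy c')).
have mE (a : R) : measurable_fun setT (fun om => (expR (a * \sum_(j <- enum J) loss c c' j (noisy c' om j)))%:E).
  by apply/measurable_EFinP; apply: measurableT_comp => //; exact: measurable_funM.
have a1 : 1 <= 1 + l by lra.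
have h := @integral_expR_sum_loss_le c c' (enum J) (1 + l) t (enum_uniq _) a1 t0.
have {h} h : (\int[PA]_om (expR ((1 + l) * \sum_(j <- enum J) loss c c' j (noisy c' om j)))%:E <=
    (expR (2 * ((1 + l) * t) ^+ 2 * #|J|%:R))%:E * P A)%E.
  by rewrite cardE; apply: h => j; rewrite mem_enum; exact: ct.
have -> : expR (2 * ((1 + l) * t) ^+ 2 * #|J|%:R - l * e) =
    expR (- (l * e)) * expR (2 * ((1 + l) * t) ^+ 2 * #|J|%:R) by rewrite -expRD addrC.
rewrite EFinM -muleA.
(* Chernoff splitting: exp L <= exp e where L <= e, and exp L <= exp((1 + l) L - l e) where L >
   e. *)
apply: (@le_trans _ _ ((expR e)%:E * (\int[PA]_om (\1_O (noisy c' om))%:E) +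
  (expR (- (l * e)))%:E * (\int[PA]_om (expR ((1 + l) * \sum_(j <- enum J) loss c c' j (noisy c' om j)))%:E))%E);
  last by rewrite leeD2l// lee_wpmul2l ?lee_fin ?expR_ge0.
rewrite -!ge0_integralZl ?lee_fin ?expR_ge0//.
have m1 : measurable_fun setT (fun om => (expR e)%:E * (\1_O (noisy c' om))%:E : \bar R)%E.
  exact: emeasurable_funM.
have m2 : measurable_fun setT (fun om => (expR (- (l * e)))%:E *
    (expR ((1 + l) * \sum_(j <- enum J) loss c c' j (noisy c' om j)))%:E)%E.
  exact: emeasurable_funM.
rewrite -ge0_integralD//; apply: ge0_le_integral => //.
- by apply: emeasurable_funM => //; apply/measurable_EFinP; exact: measurableT_comp.
- exact: emeasurable_funD.
move=> om _; rewrite -!EFinM -EFinD lee_fin.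
set L := \sum_(j <- _) _.
have := expR_ge0 ((1 + l) * L); have := expR_ge0 (- (l * e)); have := expR_ge0 e.
rewrite -expRD indicE; case: (_ \in _) => /= h1 h2 h3; last by rewrite !mul0r mulr0 add0r expR_ge0.
rewrite mul1r mulr1; have [Le|eL] := leP L e.
  by rewrite ler_wpDr ?expR_ge0// ler_expR.
by rewrite ler_wpDl ?expR_ge0// ler_expR; nra.
Qed.

End ShiftedNoise.

(** * Walks and distances *)

Section Walks.
Variables (R : realType) (n : nat).
Implicit Types (E : {set upair n}) (w : upair n -> R) (u v x y : 'I_n) (p q : seq 'I_n).

Lemma joins_sym (e : upair n) u v : joins e u v = joins e v u.
Proof. by rewrite /joins orbC. Qed.

(** The strict order inside [upair] leaves one representative per unordered pair, so that [ewt] of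
    an edge is a sum with one term. *)
Lemma joins_inj (e e' : upair n) u v : joins e u v -> joins e' u v -> e = e'.
Proof.
have lt (f : upair n) : ((val f).1 < (val f).2)%N := valP f.
move=> /orP[] /andP[/eqP e1 /eqP e2] /orP[] /andP[/eqP e1' /eqP e2']; apply: val_inj;
  have := lt e; have := lt e'; case: (val e) e1 e2 => a b; case: (val e') e1' e2' => a' b' /=;
  move=> -> -> -> -> //; lia.
Qed.

Lemma joins_exists u v : u != v -> exists e : upair n, joins e u v.
Proof.
move=> uv; have [h|h|/val_inj h] := ltngtP u v; last by rewrite h eqxx in uv.
- by exists (exist _ (u, v) h); rewrite /joins /= !eqxx.
- by exists (exist _ (v, u) h); rewrite /joins /= !eqxx orbT.
Qed.

Lemma ewt_sym E w u v : ewt E w u v = ewt E w v u.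
Proof. by apply: eq_bigl => e; rewrite joins_sym. Qed.

Lemma adjb_sym E u v : adjb E u v = adjb E v u.
Proof. by apply: eq_existsb => e; rewrite joins_sym. Qed.

Lemma ewt_joins E w (e : upair n) u v : e \in E -> joins e u v -> ewt E w u v = w e.
Proof.
move=> eE eJ; rewrite /ewt (big_pred1 e)// => f /=.
by apply/andP/eqP => [[_ fJ]|->//]; exact: joins_inj fJ eJ.
Qed.

Lemma ewt_ge0 E w u v : nonneg_weights E w -> 0 <= ewt E w u v.
Proof. by move=> w0; apply: sumr_ge0 => e /andP[eE _]; exact: w0. Qed.

Lemma walk_weight_cat E w u p q :
  walk_weight E w u (p ++ q) = walk_weight E w u p + walk_weight E w (last u p) q.
Proof. by elim: p u => [|v p IH] u /=; rewrite ?add0r// IH addrA. Qed.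

Lemma walk_weight_ge0 E w u p : nonneg_weights E w -> 0 <= walk_weight E w u p.
Proof. by move=> w0; elim: p u => [|v p IH] u //=; rewrite addr_ge0 ?ewt_ge0. Qed.

Lemma walk_weight_rev E w u p :
  walk_weight E w (last u p) (rev (belast u p)) = walk_weight E w u p.
Proof.
elim: p u => [//|v p IH] u /=.
rewrite rev_cons -cats1 walk_weight_cat IH addrC /= addr0; congr (_ + _).
rewrite ewt_sym; congr (ewt E w u _).
by case: p {IH} => //= x p; rewrite rev_cons last_rcons.
Qed.

(** Loop erasure: if [u] reappears in the shortened rest of the walk, everything before that
    occurrence is dropped, which cannot increase a nonnegative weight. *)
Lemma uniq_subwalk E w u p : nonneg_weights E w -> path (adjb E) u p ->
  exists p', [/\ path (adjb E) u p', last u p' = last u p, uniq (u :: p') &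
    walk_weight E w u p' <= walk_weight E w u p].
Proof.
move=> w0; elim: p u => [|v p IH] u /=; first by exists [::].
move=> /andP[uv /IH[p' [pp' lp' up' wp']]].
have [uin|nup] := boolP (u \in v :: p'); last first.
  by exists (v :: p'); rewrite /= uv nup; split=> //; rewrite lerD2l.
have [p1 [p2 E12]] : exists p1 p2, v :: p' = p1 ++ u :: p2.
  by case/splitPr: uin => p1 p2; exists p1, p2.
have h : path (adjb E) u (v :: p') by rewrite /= uv.
have hw : walk_weight E w u (v :: p') <= ewt E w u v + walk_weight E w v p by rewrite /= lerD2l.
have hl : last u (v :: p') = last v p by rewrite /= lp'.
rewrite E12 in h hw hl up'.
exists p2; move: h; rewrite cat_path /= => /and3P[_ _ h]; split=> //.
- by rewrite -hl last_cat.
- by move: up'; rewrite cat_uniq => /and3P[].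
- apply: le_trans hw; rewrite walk_weight_cat /=.
  by rewrite addrA lerDr addr_ge0 ?ewt_ge0 ?walk_weight_ge0.
Qed.

(** * Finite distances in a connected graph *)

Section Distance.
Variables (E : {set upair n}) (w : upair n -> R).
Hypotheses (Ec : connected_graph E) (w0 : nonneg_weights E w).
Local Notation rd u v := (fine (dist E w u v)).

(** Connectedness excludes +oo and nonnegative weights exclude -oo, so [fine] loses nothing. *)
Let distE u v : (dist E w u v = (rd u v)%:E)%E.
Proof.
rewrite fineK// ge0_fin_numE.
  have /connectP[p pp lp] := Ec u v.
  apply: (@le_lt_trans _ _ (walk_weight E w u p)%:E); last exact: ltry.
  by apply: ereal_inf_lbound; exists p; rewrite //= pp lp /=.
by apply: le_ereal_inf_tmp => _ [p _ <-]; rewrite lee_fin walk_weight_ge0.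
Qed.

Lemma rdist_le u p : path (adjb E) u p -> rd u (last u p) <= walk_weight E w u p.
Proof.
move=> pp; rewrite -lee_fin -distE; apply: ereal_inf_lbound.
by exists p; rewrite //= pp eqxx.
Qed.

Lemma rdist_ge u v (a : R) :
  (forall p, path (adjb E) u p -> last u p = v -> a <= walk_weight E w u p) -> a <= rd u v.
Proof.
move=> h; rewrite -lee_fin -distE; apply: le_ereal_inf_tmp => _ [p /andP[pp /eqP lp] <-].
by rewrite lee_fin h.
Qed.

Lemma rdist_ge0 u v : 0 <= rd u v.
Proof. by apply: rdist_ge => p _ _; exact: walk_weight_ge0. Qed.

(** The slack [a] spares a proof that the infimum is attained. Simplicity of the walk serves the
    sensitivity bound and makes the vertices in its windows distinct. *)
Lemma rdist_walk u v (a : R) : 0 < a -> exists p, [/\ path (adjb E) u p, last u p = v, uniq (u :: p) &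
  walk_weight E w u p < rd u v + a].
Proof.
move=> a0; have [p [pp lp wp]] : exists p, [/\ path (adjb E) u p, last u p = v & walk_weight E w u p < rd u v + a].
  apply: contrapT => h; have : rd u v + a <= rd u v.
    apply: rdist_ge => p pp lp; rewrite leNgt; apply/negP => wp; apply: h.
    by exists p.
  by rewrite gerDl leNgt a0.
have [p' [pp' lp' up' wp']] := uniq_subwalk w0 pp.
by exists p'; split=> //; [rewrite lp'|exact: le_lt_trans wp' wp].
Qed.

Lemma rdist_triangle u x v : rd u v <= rd u x + rd x v.
Proof.
apply/ler_addgt0Pr => a a0; have a20 : 0 < a / 2 by rewrite divr_gt0.
have [p [pp lp _ wp]] := rdist_walk u x a20.
have [q [pq lq _ wq]] := rdist_walk x v a20.
have : rd u v <= walk_weight E w u (p ++ q).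
  by rewrite -lq -lp -last_cat rdist_le// cat_path pp lp.
rewrite walk_weight_cat lp => /le_trans; apply; lra.
Qed.

Lemma rdist_sym u v : rd u v = rd v u.
Proof.
suff h x y : rd x y <= rd y x by apply/eqP; rewrite eq_le !h.
apply: rdist_ge => p pp <-.
have lE z q : last (last z q) (rev (belast z q)) = z.
  by case: q => //= b q; rewrite rev_cons last_rcons.
rewrite -walk_weight_rev -{2}(lE y p); apply: rdist_le.
by rewrite rev_path (eq_path (e' := adjb E)) // => a b; rewrite adjb_sym.
Qed.

Lemma rdist_refl u : rd u u = 0.
Proof. by apply/eqP; rewrite eq_le rdist_ge0 andbT; exact: (@rdist_le u [::]). Qed.

End Distance.

(** A simple walk uses each edge at most once. *)
Lemma walk_weight_diff E w1 w2 u p : uniq (u :: p) ->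
  walk_weight E w1 u p - walk_weight E w2 u p <= \sum_(e in E) `|w1 e - w2 e|.
Proof.
(* The induction runs on the sum over edges with both ends on the walk: the first edge has the end
   [u], absent from the rest, and is not counted again. *)
move=> up; apply: (@le_trans _ _
  (\sum_(e in E | ((val e).1 \in u :: p) && ((val e).2 \in u :: p)) `|w1 e - w2 e|)); last first.
  by rewrite big_mkcondr ler_sum// => e _; case: ifP.
elim: p u up => [|v p IH] u; first by rewrite subrr => _; exact: sumr_ge0.
rewrite cons_uniq => /andP[uvp uvp'].
have {}IH := IH v uvp'.
rewrite [leRHS](bigID (fun e => joins e u v)) /=.
have -> : ewt E w1 u v + walk_weight E w1 v p - (ewt E w2 u v + walk_weight E w2 v p) =
  (ewt E w1 u v - ewt E w2 u v) + (walk_weight E w1 v p - walk_weight E w2 v p) by ring.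
apply: lerD.
  rewrite -sumrB; apply: (@le_trans _ _ (\sum_(e in E | joins e u v) `|w1 e - w2 e|)).
    by apply: ler_sum => e _; exact: ler_norm.
  rewrite le_eqVlt; apply/orP; left; apply/eqP; apply: eq_bigl => e.
  rewrite -andbA; congr (_ && _); apply/idP/andP => [J|[]//]; split=> //.
  by case/orP: J => /andP[/eqP -> /eqP ->]; rewrite !inE !eqxx ?orbT.
apply: le_trans IH _; rewrite [leRHS]big_mkcond [leLHS]big_mkcond; apply: ler_sum => e _.
case: ifP => [/andP[eE /andP[e1 e2]]|_]; last by case: ifP.
rewrite eE !(in_cons u) e1 e2 !orbT /= ifT//.
by apply/negP => /orP[] /andP[/eqP E1 /eqP E2]; move: uvp; [rewrite -E1 e1|rewrite -E2 e2].
Qed.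

(** A nearly shortest simple walk for [w2] is also a walk for [w1]. For neighboring weights,
    distances thus move by at most 1. *)
Lemma rdist_sensitivity E w1 w2 u v : connected_graph E -> nonneg_weights E w1 -> nonneg_weights E w2 ->
  fine (dist E w1 u v) - fine (dist E w2 u v) <= \sum_(e in E) `|w1 e - w2 e|.
Proof.
move=> Ec h1 h2; apply/ler_addgt0Pr => a a0.
have [p [pp lp up wp]] := rdist_walk Ec h2 u v a0.
have h := rdist_le Ec h1 pp; rewrite lp in h.
have := walk_weight_diff E w1 w2 up; lra.
Qed.

(** * Stretch of distances in the output graph *)

Section Stretch.
Variables (E : {set upair n}) (w Z0 Z1 : upair n -> R) (S : {set 'I_n}) (b0 b1 : R).
Hypotheses (Ec : connected_graph E) (w0 : nonneg_weights E w).
Hypotheses (Z0b : forall e, 0 <= Z0 e <= b0) (Z1b : forall e, in_E1 S e -> 0 <= Z1 e <= b1).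
Local Notation rd u v := (fine (dist E w u v)).
Local Notation E' := (outE E S).
Local Notation W := (outW E w S Z0 Z1).

Lemma outW_ge0 : nonneg_weights E' W.
Proof.
move=> e _; rewrite /outW; case: ifPn => [/Z1b/andP[z _]|_].
  by rewrite addr_ge0 ?rdist_ge0.
by case: ifP => // eE; have /andP[z _] := Z0b e; rewrite addr_ge0 ?w0.
Qed.

Lemma outE_connected : connected_graph E'.
Proof.
move=> u v; apply: connect_sub (Ec u v) => x y /exists_inP[e eE eJ].
apply: connect1; apply/exists_inP; exists e => //.
by rewrite !inE eE; case: in_E1.
Qed.

(** With nonnegative noise every output edge weighs at least the true distance of its ends; the
    triangle inequality extends this to walks. *)
Lemma rdist_le_out u v : rd u v <= fine (dist E' W u v).
Proof.
have edge x y : adjb E' x y -> rd x y <= ewt E' W x y.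
  move=> /exists_inP[e eE' eJ]; rewrite (ewt_joins _ eE' eJ) /outW.
  move: eE'; rewrite !inE; case: ifPn => [/[dup] /Z1b/andP[z _] _ _|_ /= /andP[eE _]].
    have -> : rd x y = rd (val e).1 (val e).2.
      by case/orP: eJ => /andP[/eqP -> /eqP ->] //; rewrite rdist_sym.
    by rewrite lerDl.
  rewrite eE; have /andP[z _] := Z0b e.
  have xy : adjb E x y by apply/exists_inP; exists e.
  have := @rdist_le E w Ec w0 x [:: y]; rewrite /= xy addr0 => /(_ isT).
  by rewrite (ewt_joins _ eE eJ) => /le_trans; apply; rewrite lerDl.
apply: (rdist_ge outE_connected outW_ge0) => p pp <- {v}.
elim: p u pp => [|x p IH] u /=; first by rewrite rdist_refl.
move=> /andP[/edge ux /IH px].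
by apply: le_trans (rdist_triangle Ec w0 u x _) _; exact: lerD.
Qed.

Let edge0 x y : adjb E x y -> ~~ ((x \in S) && (y \in S)) ->
  adjb E' x y /\ ewt E' W x y <= ewt E w x y + b0.
Proof.
move=> /exists_inP[e eE eJ] xyS.
have eS : in_E1 S e = false.
  apply/negbTE; apply: contra xyS; rewrite /in_E1.
  by case/orP: eJ => /andP[/eqP -> /eqP ->] //; rewrite andbC.
have eE' : e \in E' by rewrite !inE eS eE.
split; first by apply/exists_inP; exists e.
rewrite (ewt_joins _ eE' eJ) (ewt_joins _ eE eJ) /outW eS eE lerD2l.
by have /andP[] := Z0b e.
Qed.

Let edge1 x y : x != y -> x \in S -> y \in S -> adjb E' x y /\ ewt E' W x y <= rd x y + b1.
Proof.
move=> xy xS yS; have [e eJ] := joins_exists xy.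
have eS : in_E1 S e.
  by rewrite /in_E1; case/orP: eJ => /andP[/eqP -> /eqP ->]; rewrite xS yS.
have eE' : e \in E' by rewrite !inE eS.
split; first by apply/exists_inP; exists e.
rewrite (ewt_joins _ eE' eJ) /outW eS.
have -> : rd (val e).1 (val e).2 = rd x y.
  by case/orP: eJ => /andP[/eqP -> /eqP ->] //; rewrite rdist_sym.
by rewrite lerD2l; have /andP[] := Z1b eS.
Qed.

(** A walk without a step inside [S] uses only edges of E0, each of which gains at most [b0]. *)
Let walk0 u p : path (adjb E) u p -> path (fun x y => ~~ ((x \in S) && (y \in S))) u p ->
  path (adjb E') u p /\ walk_weight E' W u p <= walk_weight E w u p + (size p)%:R * b0.
Proof.
elim: p u => [|v p IH] u /=; first by rewrite mul0r addr0.
move=> /andP[uv pp] /andP[uvS ppS].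
have [-> h1] := edge0 uv uvS; have [-> h2] := IH v pp ppS; split=> //.
rewrite -natr1 mulrDl mul1r.
have -> : ewt E w u v + walk_weight E w v p + ((size p)%:R * b0 + b0) =
  (ewt E w u v + b0) + (walk_weight E w v p + (size p)%:R * b0) by ring.
exact: lerD.
Qed.

Let path_belast (Q : pred 'I_n) u p : ~~ has Q (belast u p) ->
  path (fun x y => ~~ (Q x && Q y)) u p.
Proof. by elim: p u => [//|v p IH] u /=; rewrite negb_or => /andP[/negbTE -> /IH ->]. Qed.

Let path_behead (Q : pred 'I_n) u p : ~~ has Q p ->
  path (fun x y => ~~ (Q x && Q y)) u p.
Proof. by elim: p u => [//|v p IH] u /=; rewrite negb_or andbC => /andP[/IH -> /negbTE ->]; rewrite andbF. Qed.

Let split_first (Q : pred 'I_n) u p : has Q (u :: p) ->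
  exists p1 p2, [/\ p = p1 ++ p2, Q (last u p1) & ~~ has Q (belast u p1)].
Proof.
elim: p u => [|v p IH] u /=; first by rewrite orbF; exists [::], [::].
have [Qu _|Qu /= /IH[p1 [p2 [-> h1 h2]]]] := boolP (Q u); first by exists [::], (v :: p).
by exists (v :: p1), p2; rewrite /= negb_or Qu.
Qed.

Let split_last (Q : pred 'I_n) u p : Q u ->
  exists p1 p2, [/\ p = p1 ++ p2, Q (last u p1) & ~~ has Q p2].
Proof.
elim/last_ind: p => [|p v IH] Qu; first by exists [::], [::].
have [Qv|Qv] := boolP (Q v); first by exists (rcons p v), [::]; rewrite cats0 last_rcons.
have [p1 [p2 [-> h1 h2]]] := IH Qu.
by exists p1, (rcons p2 v); rewrite rcons_cat has_rcons negb_or Qv.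
Qed.

(* The walk follows p up to its first vertex x in S, jumps to its last vertex y in S, and follows p
   again; by the hypothesis on S the two pieces of p have fewer than h edges. *)
Lemma rdist_out_le u v p (h : nat) (a : R) : path (adjb E) u p -> last u p = v ->
  walk_weight E w u p <= rd u v + a ->
  ((h <= size (u :: p))%N -> has (mem S) (take h (u :: p)) /\
     has (mem S) (drop (size (u :: p) - h) (u :: p))) ->
  0 <= b0 -> 0 <= b1 ->
  fine (dist E' W u v) <= rd u v + a + (2 * h%:R * b0 + b1).
Proof.
move=> pp lp wp hit b0_ge0 b1_ge0.
have le_h q : (size q <= h)%N -> (size q)%:R * b0 <= h%:R * b0.
  by move=> qh; rewrite ler_wpM2r// ler_nat.
have [hasS|noS] := boolP (has (mem S) (u :: p)); last first.
  (* If [p] avoids [S] it is short, since otherwise its first window would meet [S]; then [p] itself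
     is followed. *)
  have ph : (size p <= h)%N.
    rewrite leqNgt; apply/negP => hp.
    have [|h1 _] := hit; first exact: leqW (ltnW hp).
    by move: noS; rewrite -(cat_take_drop h (u :: p)) has_cat h1.
  have [|p' wp'] := walk0 pp; first by apply: path_behead; move: noS; rewrite /= negb_or => /andP[].
  have := rdist_le outE_connected outW_ge0 p'; rewrite lp.
  have h0 : 0 <= h%:R * b0 by rewrite mulr_ge0.
  have := le_h _ ph; lra.
have [p1 [p' [E1 Sx nS1]]] := split_first hasS.
set x := last u p1 in Sx.
have [pm [p2 [E2 Sy nS2]]] := split_last p' Sx.
set y := last x pm in Sy.
have Ep : u :: p = (belast u p1 ++ (x :: pm)) ++ p2.
  by rewrite E1 E2 -cat_rcons -lastI /= -catA.
(* Otherwise the first window lies in the part of [p] before [x], which misses [S]; [h2] is the same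
   at the other end. *)
have h1 : (size p1 <= h)%N.
  rewrite leqNgt; apply/negP => hp.
  have [|H _] := hit; first by rewrite Ep !size_cat size_belast; lia.
  move: nS1 H; rewrite Ep -catA take_cat size_belast hp.
  by rewrite -{1}(cat_take_drop h (belast u p1)) has_cat negb_or => /andP[/negbTE ->].
have h2 : (size p2 <= h)%N.
  rewrite leqNgt; apply/negP => hp.
  have [|_ H] := hit; first by rewrite Ep !size_cat; lia.
  move: nS2 H; rewrite Ep drop_cat size_cat ifN; last by rewrite -leqNgt; lia.
  set k := (_ - _)%N.
  by rewrite -{1}(cat_take_drop k p2) has_cat negb_or => /andP[_ /negbTE ->].
move: pp; rewrite E1 E2 !cat_path => /and3P[pp1 ppm pp2].
have [q1 wq1] := walk0 pp1 (path_belast nS1).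
have [q2 wq2] := walk0 pp2 (path_behead (last x pm) nS2).
have lv : last y p2 = v by rewrite -lp E1 E2 !last_cat.
move: wp; rewrite E1 E2 !walk_weight_cat => wp.
have d1 := rdist_le outE_connected outW_ge0 q1.
have d2 := rdist_le outE_connected outW_ge0 q2.
have dm : fine (dist E' W x y) <= rd x y + b1.
  (* If the path meets [S] only once then x = y, and the jump is empty. *)
  have [->|xy] := eqVneq x y.
    by rewrite (rdist_refl outE_connected outW_ge0) rdist_refl// add0r.
  have [exy wxy] := edge1 xy Sx Sy.
  have := @rdist_le _ _ outE_connected outW_ge0 x [:: y]; rewrite /= exy addr0 => /(_ isT).
  by move=> /le_trans; apply.
have dm' := rdist_le Ec w0 ppm.
have t1 := rdist_triangle outE_connected outW_ge0 u x v.
have t2 := rdist_triangle outE_connected outW_ge0 x y v.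
rewrite lv -/x -/y in d1 d2 dm' wp wq1 wq2.
have := le_h _ h1; have := le_h _ h2; lra.
Qed.

End Stretch.
End Walks.

(** * Privacy *)

Section FiniteConditioning.
Context d (Omega : measurableType d) (R : realType) (mu : {measure set Omega -> \bar R}).
Variables (K : finType) (V : Omega -> K) (F : K -> set Omega).
Hypothesis mF : forall S, measurable (V @^-1` [set S] `&` F S).

Let conditioning (q : seq K) : uniq q ->
  measurable [set om | (V om \in q) /\ F (V om) om] /\
  mu [set om | (V om \in q) /\ F (V om) om] = (\sum_(S <- q) mu (V @^-1` [set S] `&` F S))%E.
Proof.
elim: q => [_|S q IH /= /andP[Sq /IH[mq muq]]].
  have -> : [set om | (V om \in [::]) /\ F (V om) om] = set0 :> set Omega.
    by apply/seteqP; split => om //= [].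
  by rewrite measure0 big_nil.
have -> : [set om | (V om \in S :: q) /\ F (V om) om] =
    (V @^-1` [set S] `&` F S) `|` [set om | (V om \in q) /\ F (V om) om].
  apply/seteqP; split => om /=; rewrite inE.
    by move=> [/orP[/eqP <-|h] FV]; [left|right].
  by move=> [[-> FS]|[-> FV]]; rewrite ?eqxx ?orbT.
split; first exact: measurableU.
rewrite measureU//; first by rewrite big_cons -muq.
by apply/seteqP; split => om //= [[VS _] [Vq _]]; rewrite VS (negbTE Sq) in Vq.
Qed.

Let event_enum : [set om | F (V om) om] = [set om | (V om \in index_enum K) /\ F (V om) om].
Proof. by apply/seteqP; split => om /=; rewrite mem_index_enum => // -[]. Qed.

(** The events [V = S] partition the space, and on each of them [F (V om)] is the fixed set
    [F S]. *)
Lemma measure_conditioning :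
  mu [set om | F (V om) om] = (\sum_S mu (V @^-1` [set S] `&` F S))%E.
Proof. by rewrite event_enum; have [_ ->] := conditioning (index_enum_uniq K). Qed.

End FiniteConditioning.

(** * Privacy of the algorithm *)

Section Algorithm.
Context (R : realType) (n k : nat) (eps delta gamma : R) (d : measure_display)
  (Omega : measurableType d) (P : probability Omega R).
Variables (V1 : Omega -> {set 'I_n}) (Z0 Z1 : upair n -> Omega -> R) (E : {set upair n}).
Hypotheses (k_gt0 : (0 < k)%N) (eps02 : 0 < eps < 2) (delta_le : 0 < delta <= expR (-1)).
Hypotheses (Ec : connected_graph E) (rnd : algA_randomness P k eps delta gamma V1 Z0 Z1).

Lemma ln_inv_delta_ge1 : 1 <= ln delta^-1.
Proof.
move: delta_le => /andP[d0 d1].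
rewrite lnV ?posrE// -[X in X <= _]opprK lerN2 -[X in _ <= X](expRK (-1)).
by rewrite ler_ln ?posrE ?expR_gt0.
Qed.

Lemma sigma0_gt0 : 0 < sigma0 eps.
Proof. by rewrite invr_gt0 divr_gt0//; case/andP: eps02. Qed.

Lemma sigma1_gt0 : 0 < sigma1 k eps delta.
Proof.
have l1 := ln_inv_delta_ge1; have /andP[e0 _] := eps02.
rewrite /sigma1 !mulr_gt0 ?invr_gt0 ?sqrtr_gt0 ?ltr0n ?divr_gt0//; lra.
Qed.

Let A S := V1 @^-1` [set S].
Let pS (S : {set 'I_n}) : R := if #|S| == k then ('C(n, k))%:R^-1 else 0.
Let noise S (e : upair n) := if in_E1 S e then Z1 e else Z0 e.
Let loc S (e : upair n) := if in_E1 S e then mu1 n k eps delta gamma else mu0 n eps gamma.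
Let scale S (e : upair n) := if in_E1 S e then sigma1 k eps delta else sigma0 eps.

Let scale_gt0 S e : 0 < scale S e.
Proof. by rewrite /scale; case: ifP; rewrite ?sigma0_gt0 ?sigma1_gt0. Qed.

Let pS_ge0 S : 0 <= pS S. Proof. by rewrite /pS; case: ifP. Qed.

Lemma measurable_V1 S : measurable (V1 @^-1` [set S]).
Proof. by case: rnd. Qed.

Lemma prob_V1 S : P (V1 @^-1` [set S]) = (pS S)%:E.
Proof.
have [_ _ _ law] := rnd.
have := law S (fun=> setT) (fun=> setT) (fun=> measurableT) (fun=> measurableT).
rewrite big1 ?mulr1; last by move=> e _; rewrite !laplace_probT ?sigma0_gt0 ?sigma1_gt0 ?mulr1.
by move=> <-; congr (P _); apply/seteqP; split => om //= [].
Qed.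

Let measurable_noise S e : measurable_fun setT (noise S e).
Proof. by have [_ m0 m1 _] := rnd; rewrite /noise; case: ifP. Qed.

Let noise_law S (B : upair n -> set R) : (forall e, measurable (B e)) ->
  P (A S `&` [set om | forall e, B e (noise S e om)]) =
  (pS S * \prod_e laplace_prob (loc S e) (scale S e) (B e))%:E.
Proof.
move=> mB; have [_ _ _ law] := rnd.
(* Of [Z0 e] and [Z1 e], the variable that pair [e] does not use is left unconstrained and
   contributes the factor 1. *)
have := law S (fun e => if in_E1 S e then setT else B e) (fun e => if in_E1 S e then B e else setT).
rewrite (_ : [set om | _] = A S `&` [set om | forall e, B e (noise S e om)]); last first.
  apply/seteqP; split => om /= [VS h]; split => // e; have := h e; rewrite /noise; case: ifP => // _.
    by case.
  by case.
move=> ->; first last.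
- by move=> e; case: ifP.
- by move=> e; case: ifP.
congr (_ * _)%:E; apply: eq_bigr => e _; rewrite /loc /scale; case: ifP => _.
  by rewrite laplace_probT ?mul1r ?sigma0_gt0.
by rewrite [X in _ * X]laplace_probT ?mulr1 ?sigma1_gt0.
Qed.

Section Privacy.
Variable O : set ({set upair n} * (upair n -> R)).
Hypothesis mO : out_measurable O.
Local Notation T := (g_sigma_algebraType (@boxes R (upair n))).

Let center S w (e : upair n) : R :=
  if in_E1 S e then fine (dist E w (val e).1 (val e).2) else if e \in E then w e else 0.

(** Noise exists at every pair, whereas the output is 0 outside E0 and E1. Masking makes the output
    a fixed measurable function of the noisy centers. *)
Let mask S (x : T) : T := fun e => if in_E1 S e || (e \in E) then x e else 0.

Let measurable_mask S : measurable_fun setT (mask S).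
Proof.
apply: measurable_fun_boxes => e; rewrite /mask.
by case: (_ || _); [exact: measurable_coord|exact: measurable_cst].
Qed.

Let OS S : set T := [set x | O (outE E S, mask S x)].

Let measurable_OS S : measurable (OS S).
Proof.
rewrite -[X in measurable X]setTI.
exact: (measurable_mask S measurableT (mO (outE E S))).
Qed.

Let algA_noisy S w om :
  O (algA_output E w S (Z0 ^~ om) (Z1 ^~ om)) = OS S (noisy (noise S) (center S w) om).
Proof.
rewrite /algA_output /OS /=; congr (O (_, _)); apply/funext => e.
rewrite /mask /outW /noisy /noise /center; case: ifP => _ /=; first by rewrite addrC.
by case: ifP => _; rewrite 1?addrC.
Qed.

Let event S w := [set om | O (algA_output E w S (Z0 ^~ om) (Z1 ^~ om))].

Let eventE S w : event S w = noisy (noise S) (center S w) @^-1` OS S.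
Proof. by apply/funext => om; exact: algA_noisy. Qed.

Let measurable_event S w : measurable (A S `&` event S w).
Proof.
apply: measurableI; first exact: measurable_V1.
rewrite eventE -[X in measurable X]setTI.
by apply: measurable_noisy => // e; exact: measurable_noise.
Qed.

Let privacy_cond S w1 w2 : nonneg_weights E w1 -> nonneg_weights E w2 -> neighboring E w1 w2 ->
  (P (A S `&` event S w1) <= (expR eps)%:E * P (A S `&` event S w2) + delta%:E * P (A S))%E.
Proof.
(* For a set of the wrong size the event [V1 = S] is null. *)
move=> h1 h2 h12; have [Sk|Sk] := eqVneq #|S| k; last first.
  apply: (@le_trans _ _ 0%E).
    have PA : P (A S) = 0%E by rewrite [LHS]prob_V1 /pS (negbTE Sk).
    rewrite -PA; apply: le_measure; rewrite ?inE //.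
    exact: measurable_V1.
  by rewrite adde_ge0// mule_ge0// lee_fin ?expR_ge0//; case/andP: delta_le => /ltW.
have l1 := ln_inv_delta_ge1; have s1 := sigma1_gt0; have /andP[e0 e2] := eps02.
pose J := [set e | in_E1 S e]%SET.
(* Hybrid centers: [w2] inside [S] and [w1] elsewhere. The first half of the change costs eps/2 and
   delta, the second only eps/2. *)
pose c' e := if in_E1 S e then center S w2 e else center S w1 e.
have sens u v : `|fine (dist E w1 u v) - fine (dist E w2 u v)| <= 1.
  apply/ler_normlP; split.
    rewrite opprB; apply: le_trans (rdist_sensitivity u v Ec h2 h1) _.
    by under eq_bigr do rewrite distrC.
  exact: le_trans (rdist_sensitivity u v Ec h1 h2) _.
have step1 := @noisy_approx_dp _ _ _ P _ (A S) (noise S) (loc S) (scale S) (pS S) (measurable_V1 S)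
  (measurable_noise S) (scale_gt0 S) (pS_ge0 S) (@noise_law S) (center S w1) c' (OS S) J
  (eps / 2) (3 * ln delta^-1 / (eps / 2)) (sigma1 k eps delta)^-1 (measurable_OS S).
have step2 := @noisy_pure_dp _ _ _ P _ (A S) (noise S) (loc S) (scale S) (pS S) (measurable_V1 S)
  (measurable_noise S) (scale_gt0 S) (pS_ge0 S) (@noise_law S) c' (center S w2) (OS S)
  (eps / 2) (measurable_OS S).
rewrite !eventE.
apply: (le_trans (step1 _ _ _ _)).
- by rewrite divr_gt0 ?mulr_gt0//; lra.
- by rewrite invr_gt0.
- by move=> e; rewrite inE /c' => /negbTE ->.
- move=> e; rewrite inE /c' /center /scale => ->.
  by rewrite -[leRHS]mul1r ler_wpM2r// invr_ge0 ltW.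
apply: leeD; last first.
  rewrite lee_wpmul2r// lee_fin.
  have dE : expR (- ln delta^-1) = delta.
    by rewrite lnV ?opprK ?lnK ?posrE//; case/andP: delta_le.
  rewrite -[leRHS]dE ler_expR /sigma1; apply: privacy_exponent_le => //.
  - by apply/andP; split; lra.
  - by rewrite -natrX -[2 * _]natrM ler_nat -Sk card_in_E1_leq.
rewrite (_ : expR eps = expR (eps / 2) * expR (eps / 2)); last first.
  by rewrite -expRD; congr expR; field.
rewrite EFinM -muleA lee_wpmul2l ?lee_fin ?expR_ge0//; apply: step2.
(* The centers now differ only on edges of E0, where 1 / sigma0 = eps/2. *)
apply: (@le_trans _ _ (\sum_(e in E) `|w1 e - w2 e| * (eps / 2))).
  rewrite [leRHS]big_mkcond; apply: ler_sum => e _.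
  rewrite /c' /center /scale; case: (in_E1 S e) => /=.
    by rewrite subrr normr0 mul0r; case: (e \in E); rewrite // mulr_ge0// divr_ge0// ltW.
  by case: (e \in E); rewrite /sigma0 ?invrK// subrr normr0 mul0r.
by rewrite -mulr_suml ler_piMl// divr_ge0// ltW.
Qed.

(** Summed over S, the terms delta P(V1 = S) give delta. *)
Lemma algA_private w1 w2 : nonneg_weights E w1 -> nonneg_weights E w2 -> neighboring E w1 w2 ->
  (P [set om | O (algA_output E w1 (V1 om) (Z0 ^~ om) (Z1 ^~ om))]
   <= (expR eps)%:E * P [set om | O (algA_output E w2 (V1 om) (Z0 ^~ om) (Z1 ^~ om))] + delta%:E)%E.
Proof.
move=> h1 h2 h12.
have E0 w : P [set om | O (algA_output E w (V1 om) (Z0 ^~ om) (Z1 ^~ om))] =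
    (\sum_S P (A S `&` event S w))%E.
  exact: (@measure_conditioning _ _ _ P _ V1 (fun S => event S w) (fun S => measurable_event S w)).
have PT : (\sum_S P (A S) = 1)%E.
  have mA S : measurable (V1 @^-1` [set S] `&` setT) by rewrite setIT; exact: measurable_V1.
  have PT : P setT = (\sum_S P (V1 @^-1` [set S] `&` setT))%E := measure_conditioning P mA.
  by rewrite -(probability_setT P) PT; apply: eq_bigr => S _; rewrite setIT.
rewrite !E0 -[delta%:E in leRHS]mule1 -PT !ge0_sume_distrr//.
rewrite -big_split /=; apply: lee_sum => S _; exact: privacy_cond.
Qed.

End Privacy.
End Algorithm.

(** * Accuracy *)

Section MeasurableDistance.
Context d (Omega : measurableType d) (R : realType) (n : nat).
Variables (E : {set upair n}) (W : Omega -> upair n -> R).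
Hypothesis mW : forall e, measurable_fun setT (fun om => W om e).

Lemma measurable_walk_weight u p : measurable_fun setT (fun om => walk_weight E (W om) u p).
Proof.
elim: p u => [|v p IH] u /=; first exact: measurable_cst.
apply: measurable_funD; last exact: IH.
rewrite /ewt; under eq_fun do rewrite big_mkcond.
by apply: measurable_sum => e; case: (_ && _); [exact: mW|exact: measurable_cst].
Qed.

(** There are countably many walks, so the distance is the infimum of a sequence of measurable
    functions. *)
Lemma measurable_dist u v : measurable_fun setT (fun om => dist E (W om) u v).
Proof.
pose ok (p : seq 'I_n) := path (adjb E) u p && (last u p == v).
(* Codes of no sequence, or of one that is not a walk from [u] to [v], get the neutral value +oo. *)
pose g (i : nat) om : \bar R := if unpickle i is Some p then
  if ok p then (walk_weight E (W om) u p)%:E else +oo%E else +oo%E.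
have mg i : measurable_fun setT (g i).
  rewrite /g; case: (unpickle i) => [p|]; last exact: measurable_cst.
  case: (ok p); last exact: measurable_cst.
  by apply/measurable_EFinP; exact: measurable_walk_weight.
rewrite (_ : (fun om => _) = (fun om => einfs (g^~ om) 0)); first exact: measurable_fun_einfs.
apply/funext => om; apply/eqP; rewrite eq_le; apply/andP; split.
  apply: le_ereal_inf_tmp => _ [i _ <-]; rewrite /g.
  case: (unpickle i) => [p|]; last exact: leey.
  case: ifP => okp; last exact: leey.
  by apply: ereal_inf_lbound; exists p.
apply: le_ereal_inf_tmp => _ [p okp <-]; apply: ereal_inf_lbound.
by exists (pickle p) => //; rewrite /g pickleK ifT.
Qed.

End MeasurableDistance.

(** * Accuracy of the algorithm *)

Section Accuracy.
Context (R : realType) (n k : nat) (eps delta gamma : R) (d : measure_display)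
  (Omega : measurableType d) (P : probability Omega R).
Variables (V1 : Omega -> {set 'I_n}) (Z0 Z1 : upair n -> Omega -> R) (E : {set upair n}) (w : upair n -> R).
Hypotheses (nk : n = (k * k)%N) (n2 : (2 <= n)%N) (eps02 : 0 < eps < 2).
Hypotheses (delta_le : 0 < delta <= expR (-1)) (gamma01 : 0 < gamma < 1).
Hypotheses (Ec : connected_graph E) (w0 : nonneg_weights E w).
Hypothesis rnd : algA_randomness P k eps delta gamma V1 Z0 Z1.
Local Notation rd u v := (fine (dist E w u v)).
Local Notation L := (ln (n%:R / gamma)).
Local Notation m0 := (mu0 n eps gamma).
Local Notation m1 := (mu1 n k eps delta gamma).

Let k_gt0 : (0 < k)%N. Proof. by move: n2; rewrite nk; case: k. Qed.
Let n_ge4 : (4 <= n)%N.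
Proof. by move: n2; rewrite nk; case: (k) => [|[|j]]//; nia. Qed.
Let n_gt0 : 0 < n%:R :> R. Proof. by rewrite ltr0n; apply: ltn_trans n2. Qed.

Let ratio_ge4 : 4 <= n%:R / gamma.
Proof.
have /andP[g0 g1] := gamma01.
rewrite ler_pdivlMr//; have : 4 <= n%:R :> R by rewrite (ler_nat R 4).
nra.
Qed.

Let L_ge1 : 1 <= L. Proof. exact: ln_ge1. Qed.

Let m0_le : 0 < m0 <= 4 * L / eps.
Proof.
have /andP[g0 g1] := gamma01; have /andP[e0 e2] := eps02.
have h : n%:R / gamma <= (n ^ 2)%:R / gamma <= (n%:R / gamma) ^+ 2.
  rewrite natrX exprMn exprVn; apply/andP; split.
    rewrite ler_pM2r ?invr_gt0// expr2 -[X in X <= _]mulr1 ler_pM2l// (ler_nat R 1).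
    exact: ltn_trans n2.
  rewrite ler_pM2l ?exprn_gt0// lef_pV2 ?posrE ?exprn_gt0//.
  by rewrite expr2 -[X in _ <= X]mulr1 ler_pM2l// ltW.
have /andP[h1 h2] := h.
have r0 : 0 < n%:R / gamma by rewrite divr_gt0.
have l1 : L <= ln ((n ^ 2)%:R / gamma) by rewrite ler_ln ?posrE// (lt_le_trans r0).
have l2 : ln ((n ^ 2)%:R / gamma) <= 2 * L.
  rewrite [2 * L]mulr_natl -lnXn// ler_ln ?posrE ?exprn_gt0//; exact: lt_le_trans h1.
have s0 := sigma0_gt0 eps02.
apply/andP; split; first by rewrite /mu0 mulr_gt0//; have := L_ge1; lra.
rewrite /mu0 (_ : 4 * L / eps = sigma0 eps * (2 * L)); last by rewrite /sigma0; field; exact: lt0r_neq0.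
by rewrite ler_wpM2l// ltW.
Qed.

Let m1_gt0 : 0 < m1.
Proof. by rewrite mulr_gt0 ?sigma1_gt0//; have := L_ge1; lra. Qed.

Let in_range (m z : R) : `[0, 2 * m]%classic z -> 0 <= z <= 2 * m.
Proof. by rewrite /= in_itv. Qed.

(** [Z1] is constrained only inside [S]: a failure probability gamma / n per pair is affordable for
    at most k^2 = n pairs. *)
Let rect (S : {set 'I_n}) (om : Omega) : Prop := forall e, `[0, 2 * m0]%classic (Z0 e om) /\
  (if in_E1 S e then `[0, 2 * m1]%classic else (setT : set R)) (Z1 e om).

Let tail0 : laplace_prob m0 (sigma0 eps) `[0, 2 * m0]%classic >= 1 - gamma / (n ^ 2)%:R.
Proof.
have /andP[g0 g1] := gamma01; have s0 := sigma0_gt0 eps02; have /andP[m00 _] := m0_le.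
rewrite laplace_prob_itv// lerD2l lerN2 /mu0 mulrC mulKf ?lt0r_neq0//.
have q0 : 0 < (n ^ 2)%:R / gamma by rewrite divr_gt0// natrX exprn_gt0.
by rewrite expRN lnK ?posrE// invf_div.
Qed.

Let tail1 : laplace_prob m1 (sigma1 k eps delta) `[0, 2 * m1]%classic >= 1 - gamma / n%:R.
Proof.
have /andP[g0 g1] := gamma01; have s1 := sigma1_gt0 k_gt0 eps02 delta_le.
rewrite laplace_prob_itv// lerD2l lerN2 /mu1 mulrC mulKf ?lt0r_neq0//.
by rewrite expRN lnK ?posrE ?divr_gt0// invf_div.
Qed.

(** At most n^2 failures of probability gamma / n^2 and at most n of probability gamma / n; each sum
    is at most gamma. *)
Let prob_rect (S : {set 'I_n}) : #|S| = k ->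
  (('C(n, k)%:R^-1 * (1 - 2 * gamma))%:E <= P [set om | V1 om = S /\ rect S om])%E.
Proof.
move=> Sk; have [_ _ _ law] := rnd; have /andP[g0 g1] := gamma01.
have s0 := sigma0_gt0 eps02; have s1 := sigma1_gt0 k_gt0 eps02 delta_le.
rewrite (law S (fun=> `[0, 2 * m0]%classic)
  (fun e => if in_E1 S e then `[0, 2 * m1]%classic else setT)); first last.
- by move=> e; case: ifP => _; [exact: measurable_itv|exact: measurableT].
- by move=> e; exact: measurable_itv.
rewrite Sk eqxx lee_fin ler_wpM2l ?invr_ge0//.
pose a (e : upair n) : R := gamma / (n ^ 2)%:R + (if in_E1 S e then gamma / n%:R else 0).
have gn0 : 0 <= gamma / (n ^ 2)%:R <= 2^-1.
  apply/andP; split; first by rewrite divr_ge0// ltW.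
  rewrite ler_pdivrMr ?natrX ?exprn_gt0//.
  have : 4 <= n%:R :> R by rewrite (ler_nat R 4).
  by rewrite expr2; nra.
have gn1 : 0 <= gamma / n%:R <= 2^-1.
  apply/andP; split; first by rewrite divr_ge0// ltW.
  rewrite ler_pdivrMr//.
  have : 4 <= n%:R :> R by rewrite (ler_nat R 4).
  lra.
have a01 e : 0 <= a e <= 1.
  by rewrite /a; case: ifP => _; move: gn0 gn1 => /andP[? ?] /andP[? ?]; apply/andP; split; lra.
apply: (@le_trans _ _ (\prod_e (1 - a e))); last first.
  apply: ler_prod => e _; apply/andP; split; first by have := a01 e; lra.
  rewrite /a; case: ifP => _; last by rewrite laplace_probT// mulr1 addr0.
  have := tail0; have := tail1.
  set x := laplace_prob _ _ _; set y := laplace_prob _ _ _ => h1 h2.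
  by move: gn0 gn1 => /andP[? ?] /andP[? ?]; nra.
apply: le_trans (prod_1B_ge a01); rewrite lerD2l lerN2.
rewrite /a big_split /= -big_mkcond /= !sumr_const.
rewrite (_ : 2 * gamma = gamma + gamma); last by ring.
have g0' := ltW g0.
apply: lerD; rewrite -[leLHS]mulr_natr mulrAC ler_pdivrMr ?natrX ?exprn_gt0//; rewrite ler_wpM2l//.
  by rewrite -natrX ler_nat card_upair_leq.
rewrite ler_nat; have := card_in_E1_leq S; rewrite Sk -mulnn -nk cardsE => h.
by apply: leq_trans h; rewrite mul2n -addnn leq_addr.
Qed.

(** The length exceeds 2 k L, so a window is missed with probability at most exp(-window k / n) =
    exp(-window / k) <= (gamma / n)^2. *)
Let window := (Num.truncn (2 * k%:R * L)).+1.

Let h_itv : 2 * k%:R * L < window%:R <= 2 * k%:R * L + 1.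
Proof.
have x0 : 0 <= 2 * k%:R * L by rewrite !mulr_ge0//; have := L_ge1; lra.
have /andP[h1 h2] := truncn_itv x0.
by rewrite /window; apply/andP; split => //; rewrite -natr1 lerD2r.
Qed.

(** At most 2 n^2 windows, each missed by a fraction of at most (gamma / n)^2 of the k-subsets. *)
Let hitting_fraction (ws : seq (seq 'I_n)) : (size ws <= 2 * n ^ 2)%N ->
  (forall q, q \in ws -> uniq q /\ size q = window) ->
  1 - 2 * gamma ^+ 2 <= #|[set S : {set 'I_n} | (#|S| == k) && all (has (mem S)) ws]%SET|%:R / 'C(n, k)%:R.
Proof.
move=> sws hws; have := @bin_leq_card_hitting _ k window ws hws; rewrite card_ord.
set G := #|_| => cG.
have /andP[g0 g1] := gamma01.
have kn : (k <= n)%N by rewrite nk leq_pmull.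
have C0 : 0 < 'C(n, k)%:R :> R by rewrite ltr0n bin_gt0.
rewrite ler_pdivlMr//.
have := @bin_sub_le_expR R n window k (ltnW n2).
have -> : window%:R * k%:R / n%:R = window%:R / k%:R :> R.
  by rewrite nk natrM; field; rewrite lt0r_neq0// ltr0n.
have eh : expR (- (window%:R / k%:R)) <= (gamma / n%:R) ^+ 2.
  apply: (@le_trans _ _ (expR (- (2 * L)))).
    rewrite ler_expR lerN2 ler_pdivlMr ?ltr0n//.
    by have /andP[h1 _] := h_itv; apply: le_trans (ltW h1); rewrite mulrAC.
  rewrite [2 * L]mulr_natl -lnXn; last by apply: lt_le_trans ratio_ge4.
  rewrite expRN lnK ?posrE ?exprn_gt0//; last by apply: lt_le_trans ratio_ge4.
  by rewrite -exprVn invf_div.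
move=> ch.
have cn : 'C(n - window, k)%:R <= 'C(n, k)%:R * (gamma / n%:R) ^+ 2 :> R.
  by apply: le_trans ch _; rewrite ler_wpM2l.
have : 'C(n, k)%:R <= G%:R + (size ws)%:R * 'C(n - window, k)%:R :> R.
  by rewrite -natrM -natrD ler_nat.
have sw : (size ws)%:R <= 2 * n%:R ^+ 2 :> R by rewrite -natrX -[2 * _]natrM ler_nat.
have : (size ws)%:R * 'C(n - window, k)%:R <= 2 * n%:R ^+ 2 * ('C(n, k)%:R * (gamma / n%:R) ^+ 2) :> R.
  by apply: ler_pM.
have -> : 2 * n%:R ^+ 2 * ('C(n, k)%:R * (gamma / n%:R) ^+ 2) = 2 * gamma ^+ 2 * 'C(n, k)%:R :> R.
  by field; rewrite lt0r_neq0.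
lra.
Qed.

Let bound : R := 100 * eps^-1 * Num.sqrt n%:R * L ^+ 2 * Num.sqrt (ln delta^-1).

Let accurate (S : {set 'I_n}) (om : Omega) : Prop :=
  (forall e, e \in outE E S -> 0 <= outW E w S (Z0 ^~ om) (Z1 ^~ om) e) /\
  (forall u v, `|fine (dist (outE E S) (outW E w S (Z0 ^~ om) (Z1 ^~ om)) u v) - rd u v| <= bound).

Let measurable_accurate S : measurable (V1 @^-1` [set S] `&` accurate S).
Proof.
have [_ mZ0 mZ1 _] := rnd.
apply: measurableI; first exact: (measurable_V1 rnd).
have mW e : measurable_fun setT (fun om => outW E w S (Z0 ^~ om) (Z1 ^~ om) e).
  rewrite /outW; case: (in_E1 S e); first exact: measurable_funD.
  by case: (e \in E); [exact: measurable_funD|exact: measurable_cst].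
have mset (b : Omega -> bool) : measurable_fun setT b -> measurable [set om | b om].
  by move=> mb; rewrite -[X in measurable X]setTI; exact: (mb measurableT [set true]).
rewrite (_ : accurate S =
  (\bigcap_(e in [set e | e \in outE E S]) [set om | 0 <= outW E w S (Z0 ^~ om) (Z1 ^~ om) e]) `&`
  (\bigcap_(uv in [set: 'I_n * 'I_n]) [set om | `|fine (dist (outE E S)
     (outW E w S (Z0 ^~ om) (Z1 ^~ om)) uv.1 uv.2) - rd uv.1 uv.2| <= bound])); last first.
  apply/seteqP; split => om [h1 h2]; split.
  - by move=> e /= eE; exact: h1.
  - by move=> [u v] _ /=; exact: h2.
  - by move=> e eE; exact: h1.
  - by move=> u v; exact: (h2 (u, v)).
apply: measurableI; apply: fin_bigcap_measurable; try exact: finite_finset.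
- move=> e _; apply: mset; apply: measurable_fun_ler => //.
- move=> [u v] _; apply: mset; apply: measurable_fun_ler => //.
  apply: measurableT_comp => //; apply: measurable_funB => //.
  apply: measurableT_comp; first exact: fine_measurable.
  exact: measurable_dist.
Qed.

Lemma algA_accurate :
  ((1 - 4 * gamma)%:E <= P [set om |
     (forall e, e \in outE E (V1 om) -> (0 <= outW E w (V1 om) (Z0 ^~ om) (Z1 ^~ om) e)%R) /\
     (forall u v : 'I_n,
        (`| fine (dist (outE E (V1 om)) (outW E w (V1 om) (Z0 ^~ om) (Z1 ^~ om)) u v) - rd u v | <=
          100 * eps^-1 * Num.sqrt n%:R * L ^+ 2 * Num.sqrt (ln (delta^-1)))%R)])%E.
Proof.
have /andP[g0 g1] := gamma01; have [m00 m0L] := andP m0_le.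
rewrite [leRHS](_ : _ = \sum_S P (V1 @^-1` [set S] `&` accurate S))%E; last first.
  exact: (@measure_conditioning _ _ _ P _ V1 accurate measurable_accurate).
(* For gamma >= 1/4 the bound is trivial; below that, 1 - 2 gamma is nonnegative and may multiply
   inequalities. *)
have [g4|g4] := leP (4^-1) gamma.
  by apply: (@le_trans _ _ 0%E); [rewrite lee_fin; lra|exact: sume_ge0].
(* The paths, of slack 1, depend on the weights alone and are fixed before [V1] is drawn. *)
have [f fP] := choice (fun uv : 'I_n * 'I_n => rdist_walk Ec w0 uv.1 uv.2 ltr01).
pose q uv := uv.1 :: f uv.
pose long := [seq uv <- enum {: 'I_n * 'I_n} | (window <= size (q uv))%N].
pose ws := [seq take window (q uv) | uv <- long] ++ [seq drop (size (q uv) - window) (q uv) | uv <- long].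
have uq uv : uniq (q uv) by have [] := fP uv.
have ws_size : (size ws <= 2 * n ^ 2)%N.
  rewrite size_cat !size_map addnn -mul2n leq_mul2l /=.
  apply: leq_trans (size_subseq (filter_subseq _ _)) _.
  by rewrite -cardE card_prod card_ord mulnn.
have ws_window p : p \in ws -> uniq p /\ size p = window.
  rewrite mem_cat => /orP[] /mapP[uv]; rewrite mem_filter => /andP[hq _] ->.
    by split; [exact: take_uniq|rewrite size_takel].
  by split; [exact: drop_uniq|rewrite size_drop subKn].
have hits uv (S : {set 'I_n}) : all (has (mem S)) ws -> (window <= size (q uv))%N ->
    has (mem S) (take window (q uv)) /\ has (mem S) (drop (size (q uv) - window) (q uv)).
  move=> /allP aS hq; have uvl : uv \in long by rewrite mem_filter hq mem_enum.
  by split; apply: aS; rewrite mem_cat; apply/orP; [left|right]; apply/mapP; exists uv.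
have frac := hitting_fraction ws_size ws_window.
pose good := [set S : {set 'I_n} | (#|S| == k) && all (has (mem S)) ws]%SET.
apply: (@le_trans _ _ (\sum_(S in good) ('C(n, k)%:R^-1 * (1 - 2 * gamma))%:E)%E).
  rewrite sumEFin lee_fin sumr_const -[leRHS]mulr_natr.
  rewrite (_ : _ * #|good|%:R = (1 - 2 * gamma) * (#|good|%:R / 'C(n, k)%:R)); last by ring.
  have c0 : 0 <= 1 - 2 * gamma by lra.
  (* (1 - 2 gamma) (1 - 2 gamma^2) >= 1 - 4 gamma, as gamma^2 <= gamma. *)
  apply: le_trans (ler_wpM2l c0 frac); nra.
apply: (@le_trans _ _ (\sum_(S in good) P (V1 @^-1` [set S] `&` accurate S))%E); last first.
  rewrite [leRHS](bigID (fun S => S \in good))/=.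
  by apply: leeDl; exact: sume_ge0.
apply: lee_sum => S; rewrite inE => /andP[/eqP Sk Sw].
apply: le_trans (prob_rect Sk) _.
apply: le_measure; rewrite ?inE.
- have [_ mZ0 mZ1 _] := rnd.
  rewrite (_ : [set om | _] = V1 @^-1` [set S] `&` \bigcap_(e in [set: upair n])
    (Z0 e @^-1` `[0, 2 * m0]%classic `&`
     Z1 e @^-1` (if in_E1 S e then `[0, 2 * m1]%classic else (setT : set R)))); last first.
    by apply/seteqP; split => om [VS rS]; split => // e; [move=> _|]; exact: rS.
  apply: measurableI; first exact: (measurable_V1 rnd).
  apply: fin_bigcap_measurable => [|e _]; first exact: finite_finset.
  rewrite -[Z0 e @^-1` _]setTI -[Z1 e @^-1` _]setTI; apply: measurableI.
    by apply: mZ0 => //; exact: measurable_itv.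
  by apply: mZ1 => //; case: (in_E1 S e); [exact: measurable_itv|exact: measurableT].
- exact: measurable_accurate.
move=> om /= [VS rS]; split=> //.
have b0P e : 0 <= Z0 e om <= 2 * m0 by have [/in_range] := rS e.
have b1P e : in_E1 S e -> 0 <= Z1 e om <= 2 * m1.
  by move=> eS; have [_] := rS e; rewrite eS => /in_range.
split; first exact: (outW_ge0 Ec w0 b0P b1P).
move=> u v; have lo := rdist_le_out Ec w0 b0P b1P u v.
(* Distances only grow, so an upper bound on the new distance is all that remains. *)
rewrite ger0_norm ?subr_ge0// lerBlDl.
have [pp lp _ wp] := fP (u, v).
have m00' := ltW m00; have m10 := ltW m1_gt0.
have b00 : 0 <= 2 * m0 by rewrite mulr_ge0.
have b10 : 0 <= 2 * m1 by rewrite mulr_ge0.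
have up := rdist_out_le Ec w0 b0P b1P pp lp (ltW wp) (hits (u, v) S Sw) b00 b10.
apply: (le_trans up).
have sn : Num.sqrt n%:R = k%:R :> R.
  by rewrite [X in X%:R]nk natrM -expr2 sqrtr_sqr ger0_norm.
rewrite -addrA lerD2l /bound sn.
apply: accuracy_bound => //.
- by rewrite (ler_nat R 1).
- by rewrite -[X in X <= _]sqrtr1 ler_wsqrtr//; exact: ln_inv_delta_ge1.
- by have /andP[h1 h2] := h_itv; rewrite h2 andbT.
Qed.

End Accuracy.

Theorem mainTheorem1 :
  exists C : nat, (0 < C)%N /\
  forall (R : realType) (n k : nat) (E : {set upair n}) (w : upair n -> R)
    (eps delta gamma : R),
    n = (k * k)%N -> (2 <= n)%N ->
    connected_graph E -> nonneg_weights E w ->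
    0 < eps < 2 -> 0 < delta <= expR (-1) -> 0 < gamma < 1 ->
    forall (d : measure_display) (Omega : measurableType d)
      (P : probability Omega R)
      (V1 : Omega -> {set 'I_n}) (Z0 Z1 : upair n -> Omega -> R),
    algA_randomness P k eps delta gamma V1 Z0 Z1 ->
    (* (eps, delta)-differential privacy with respect to the weights *)
    (forall w1 w2 : upair n -> R,
       nonneg_weights E w1 -> nonneg_weights E w2 -> neighboring E w1 w2 ->
       forall O : set ({set upair n} * (upair n -> R)), out_measurable O ->
       (P [set om | O (algA_output E w1 (V1 om) (Z0 ^~ om) (Z1 ^~ om))]
        <= (expR eps)%:E *
           P [set om | O (algA_output E w2 (V1 om) (Z0 ^~ om) (Z1 ^~ om))]
           + delta%:E)%E)
    /\
    (* accuracy *)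
    ((1 - 4 * gamma)%:E <=
     P [set om |
        (forall e, e \in outE E (V1 om) ->
           (0 <= outW E w (V1 om) (Z0 ^~ om) (Z1 ^~ om) e)%R) /\
        (forall u v : 'I_n,
           (`| fine (dist (outE E (V1 om)) (outW E w (V1 om) (Z0 ^~ om) (Z1 ^~ om)) u v)
              - fine (dist E w u v) |
           <= C%:R * eps^-1 * Num.sqrt n%:R * ln (n%:R / gamma) ^+ 2
                * Num.sqrt (ln (delta^-1)))%R)])%E.
Proof.
exists 100%N; split=> // R n k E w eps delta gamma nk n2 Ec w0 eps02 delta_le gamma01 d Omega P V1 Z0 Z1 rnd.
have k0 : (0 < k)%N by move: n2; rewrite nk; case: k {nk rnd}.
split; last exact: (algA_accurate nk n2 eps02 delta_le gamma01 Ec w0 rnd).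
move=> w1 w2 h1 h2 h12 O mO.
exact: (algA_private k0 eps02 delta_le Ec rnd mO h1 h2 h12).
Qed.
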